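(* Let $\Gamma$ be a finite simple graph, $A_\Gamma$ the associated right-angled Artin group, and let $\phi\in\mathrm{Aut}(A_\Gamma)$ be a composition of inversions. Then the $\phi$-twisted conjugacy problem $\mathrm{TCP}_\phi(A_\Gamma)$ is solvable in linear time.
   Context: The right-angled Artin group is $A_\Gamma = \langle V(\Gamma) \mid [s,t]=1 \text{ for all } \{s,t\}\in E(\Gamma)\rangle$, with $X=V(\Gamma)\cup V(\Gamma)^{-1}$. An inversion is the automorphism sending one vertex $x\in V(\Gamma)$ to $x^{-1}$ and fixing all other vertices. Elements $u,v\in A_\Gamma$ are $\phi$-twisted conjugate if $v=\phi(w)^{-1}uw$ for some $w\in A_\Gamma$; $\mathrm{TCP}_\phi(A_\Gamma)$ asks for an algorithm that, given two words over $X$, decides whether they represent $\phi$-twisted conjugate elements. Time is measured in the total length of the input words on a random access machine (basic integer arithmetic operations take constant time). *)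

(* Defs.v *)
From mathcomp Require Import all_boot.
From Stdlib Require Import Relations.
Set Implicit Arguments. Unset Strict Implicit. Unset Printing Implicit Defensive.

(* Vertices of Gamma are 'I_n; the graph is given by a symmetric irreflexive
   relation e.  A letter of X = V u V^{-1} is (x, b) with b = true meaning x^{-1}. *)
Definition letter (n : nat) := ('I_n * bool)%type.

Definition linv n (a : letter n) : letter n := (a.1, ~~ a.2).

Inductive raag_step n (e : rel 'I_n) : seq (letter n) -> seq (letter n) -> Prop :=
| RS_cancel s1 s2 a : raag_step e (s1 ++ [:: a; linv a] ++ s2) (s1 ++ s2)
| RS_comm s1 s2 a b : e a.1 b.1 ->
    raag_step e (s1 ++ [:: a; b] ++ s2) (s1 ++ [:: b; a] ++ s2).

Definition raag_eq n (e : rel 'I_n) : relation (seq (letter n)) :=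
  clos_refl_sym_trans _ (@raag_step n e).

Definition inversion n (x : 'I_n) (a : letter n) : letter n :=
  if a.1 == x then linv a else a.

Definition phi_letter n (xs : seq 'I_n) : letter n -> letter n :=
  foldr (fun x f => inversion x \o f) id xs.

Definition phi_word n (xs : seq 'I_n) (w : seq (letter n)) := map (phi_letter xs) w.
Definition inv_word n (w : seq (letter n)) := rev (map (@linv n) w).

Definition twisted_conj n (e : rel 'I_n) (xs : seq 'I_n) (u v : seq (letter n)) :=
  exists w, raag_eq e v (inv_word (phi_word xs w) ++ u ++ w).

Inductive instr :=
| IConst (d c : nat)
| IAdd (d a b : nat)
| ISub (d a b : nat)          (* R[d] := R[a] - R[b] (truncated) *)
| IMul (d a b : nat)
| IDiv (d a b : nat)          (* R[d] := R[a] / R[b] (0 if R[b] = 0) *)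
| IMod (d a b : nat)
| ILoad (d a : nat)
| IStore (a s : nat)
| IJz (r t : nat)
| IHalt.

Definition program := seq instr.
Definition ram_state := (nat * (nat -> nat))%type.

Definition upd (m : nat -> nat) (d x : nat) : nat -> nat :=
  fun i => if i == d then x else m i.

Definition ram_step (P : program) (s : ram_state) : option ram_state :=
  let: (pc, m) := s in
  match nth IHalt P pc with
  | IConst d c => Some (pc.+1, upd m d c)
  | IAdd d a b => Some (pc.+1, upd m d (m a + m b))
  | ISub d a b => Some (pc.+1, upd m d (m a - m b))
  | IMul d a b => Some (pc.+1, upd m d (m a * m b))
  | IDiv d a b => Some (pc.+1, upd m d (m a %/ m b))
  | IMod d a b => Some (pc.+1, upd m d (m a %% m b))
  | ILoad d a => Some (pc.+1, upd m d (m (m a)))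
  | IStore a s' => Some (pc.+1, upd m (m a) (m s'))
  | IJz r t => Some (if m r == 0 then t else pc.+1, m)
  | IHalt => None
  end.

Fixpoint ram_run (P : program) (fuel : nat) (s : ram_state) : option (nat -> nat) :=
  match ram_step P s with
  | None => Some s.2
  | Some s' => if fuel is f.+1 then ram_run P f s' else None
  end.

Definition code n (a : letter n) : nat := (2 * nat_of_ord a.1 + a.2).+1.

Definition ram_input n (u v : seq (letter n)) : ram_state :=
  (0, fun i =>
        if i == 0 then size u
        else if i == 1 then size v
        else if i < 2 + size u then
          (if u is a :: _ then code (nth a u (i - 2)) else 0)
        else if i < 2 + size u + size v then
          (if v is a :: _ then code (nth a v (i - 2 - size u)) else 0)
        else 0).

(* Main.v *)
(** Up to commutations, a word is determined by its projections to the pairs of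
    noncommuting vertices.  A reduced word [g] can be shrunk when it has the form
    [phi a . h . a^-1], and rotated from [a . h] to [h . phi a].  Shrinking is
    confluent modulo rotations, so [u] and [v] are twisted conjugate iff their fully
    shrunk forms [g] and [q] satisfy [g . phi t = t . q] for some trace [t] of letters
    to be rotated.  Cutting periods [g . phi g] out of [t], on a set of vertices
    closed under noncommutation, gives a [t] of length linear in [g].  It can be found
    greedily: if [g] and [q] differ on a pair of vertices, then the first letter of [g]
    on that pair has to be rotated, and so has every letter blocking one that has to be.

    On a machine with unbounded integers, each projection is kept in one register as a
    number in base [2n + 1], and adding, testing or deleting a letter at either end of
    a word takes a number of operations bounded in terms of [n]. *)

(* A composition of inversions keeps the vertex of every letter and is an involution. So it acts
   letterwise on each projection, and a rotation can be undone by rotating further, through two full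
   periods. Fully shrunk forms are not unique, and two shrinkings of a word are comparable only
   modulo rotations; but a single rotation is always answered by at most one, which keeps the
   confluence argument local. Soundness and completeness are separated. Every shrinking and every
   rotation is a twisted conjugation, so equality at the end proves conjugacy, whatever was rotated.
   The trace [t] is never computed: when it exists, it shows that the greedy choices are forced and
   how many rounds suffice. The bound on [t] comes from free monoids. On one pair of noncommuting
   vertices, [t] has to follow the periodic word [g . phi g . g ...], so heavy use of one vertex
   forces heavy use of the other. Each passage from a vertex to the next costs one period, and a
   pigeonhole over the [n] vertices finds a level where nothing more is lost. *)
From Stdlib Require Import Relations.
From Stdlib Require Classical_Prop.
Require Import Defs.
From mathcomp Require Import all_boot zify.
Set Implicit Arguments. Unset Strict Implicit. Unset Printing Implicit Defensive.

(** * Confluence modulo an equivalence *)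

Section ChurchRosserModulo.
Variables (T : Type) (sz : T -> nat) (R S E : relation T).
Hypothesis R_sz : forall g h, R g h -> sz h < sz g.
Hypothesis S_sz : forall g h, S g h -> sz h = sz g.
Hypothesis S_sym : forall g h, S g h -> S h g.
Hypothesis RR : forall g g1 g2, R g g1 -> R g g2 ->
  exists h, (R g1 h \/ S g1 h) /\ (R g2 h \/ S g2 h).
Hypothesis RS : forall g g1 g', R g g1 -> S g g' ->
  exists h, R g' h /\ (R g1 h \/ S g1 h).
Hypothesis E_refl : forall g, E g g.
Hypothesis E_sym : forall g h, E g h -> E h g.
Hypothesis E_trans : forall g h k, E g h -> E h k -> E g k.
Hypothesis S_E : forall g h, S g h -> E g h.

Definition irreducible g := forall h, ~ R g h.
Definition normalizes g p := clos_refl_trans_1n _ R g p /\ irreducible p.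

Lemma normalizes_ex g : exists p, normalizes g p.
Proof.
have [k] := ubnP (sz g); elim: k g => // k IH g lek.
case: (Classical_Prop.classic (exists h, R g h)) => [[h Rgh]|nR].
  have [|p [hp ip]] := IH h; first exact: leq_trans (R_sz Rgh) _.
  by exists p; split => //; apply: Relation_Operators.rt1n_trans Rgh hp.
by exists g; split; [apply: Relation_Operators.rt1n_refl|move=> h Rgh; apply: nR; exists h].
Qed.

(** The two claims need each other: closing a fork leaves smaller elements related by at most one
    step, which may be of either kind. A single [S] step is enough because [RS] never returns a
    longer chain. *)
Lemma normalizes_unique_sz k :
  (forall g p q, sz g < k -> normalizes g p -> normalizes g q -> E p q) /\
  (forall g g' p q, sz g < k -> S g g' -> normalizes g p -> normalizes g' q -> E p q).
Proof.
elim: k => [|k [IH1 IH2]]; first by split.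
have ext g h p : R g h -> normalizes h p -> normalizes g p.
  by move=> Rgh [hp ip]; split => //; apply: Relation_Operators.rt1n_trans Rgh hp.
have split1 g p : normalizes g p -> (p = g /\ irreducible g) \/ exists2 h, R g h & normalizes h p.
  by case=> hp; case: hp => [|h p' Rgh hp] ip; [left|right; exists h].
have joint g1 h p z : sz g1 < k -> R g1 h \/ S g1 h ->
    normalizes g1 p -> normalizes h z -> E p z.
  move=> lt [Rg|Sg] np nz; first exact: IH1 lt np (ext _ _ _ Rg nz).
  exact: IH2 lt Sg np nz.
have step1 g p q : sz g < k.+1 -> normalizes g p -> normalizes g q -> E p q.
  move=> lt /split1[[-> ig]|[g1 R1 n1]] /split1[[-> ig']|[g2 R2 n2]] //.
  - by case: (ig g2).
  - by case: (ig' g1).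
  have [h [h1 h2]] := RR R1 R2; have [z nz] := normalizes_ex h.
  have l1 := leq_trans (R_sz R1) (ltnSE lt); have l2 := leq_trans (R_sz R2) (ltnSE lt).
  exact: E_trans (joint _ _ _ _ l1 h1 n1 nz) (E_sym (joint _ _ _ _ l2 h2 n2 nz)).
split=> // g g' p q lt Sg /split1[[-> ig]|[g1 R1 n1]] nq.
  (* An [S]-neighbour of an irreducible element is irreducible: by [RS], an [R] step from it would
     yield one from [g]. *)
  case/split1: (nq) => [[-> _]|[g2 R2 _]]; first exact: S_E.
  by have [h [/ig]] := RS R2 (S_sym Sg).
have [h [Rh h1]] := RS R1 Sg; have [z nz] := normalizes_ex h.
have l1 := leq_trans (R_sz R1) (ltnSE lt).
apply: E_trans (joint _ _ _ _ l1 h1 n1 nz) _.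
by apply: (step1 g') nq; rewrite ?(S_sz Sg) //; apply: ext nz.
Qed.

Lemma church_rosser_modulo g g' p q :
  clos_refl_sym_trans _ (fun x y => R x y \/ S x y) g g' ->
  normalizes g p -> normalizes g' q -> E p q.
Proof.
move=> h; elim: h p q => {g g'} [g g' h|g|g g' _ IH|g h g' _ IH1 _ IH2] p q np nq.
- have [U1 U2] := normalizes_unique_sz (sz g).+1.
  case: h => h; last exact: (U2 _ _ _ _ (ltnSn _) h np nq).
  apply: (U1 _ _ _ (ltnSn _) np); case: nq => hq iq; split => //.
  exact: Relation_Operators.rt1n_trans h hq.
- exact: (normalizes_unique_sz (sz g).+1).1 np nq.
- exact/E_sym/IH.
- have [z nz] := normalizes_ex h.
  exact: E_trans (IH1 _ _ np nz) (IH2 _ _ nz nq).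
Qed.

End ChurchRosserModulo.

(** * A structured language for the random access machine *)

Section Compilation.

(** Quantifying over the remaining fuel lets runs compose by adding their lengths, without
    presupposing that the program halts. *)
Definition steps (P : program) k s s' := forall f, ram_run P (k + f) s = ram_run P f s'.

Lemma steps0 P s : steps P 0 s s. Proof. by []. Qed.

Lemma steps_trans P k l s1 s2 s3 : steps P k s1 s2 -> steps P l s2 s3 -> steps P (k + l) s1 s3.
Proof. by move=> h1 h2 f; rewrite -addnA h1 h2. Qed.

Lemma steps1 P s s' : ram_step P s = Some s' -> steps P 1 s s'.
Proof. by move=> h f; rewrite add1n [LHS]/= h. Qed.

Definition code_at (P : program) o (l : seq instr) :=
  forall j, j < size l -> nth IHalt P (o + j) = nth IHalt l j.

Lemma code_at_cat P o l1 l2 : code_at P o (l1 ++ l2) ->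
  code_at P o l1 /\ code_at P (o + size l1) l2.
Proof.
move=> h; split=> j lt.
  by rewrite h ?nth_cat ?lt // size_cat ltn_addr.
by rewrite -addnA h ?size_cat ?ltn_add2l // nth_cat ltnNge leq_addr addKn.
Qed.

Lemma code_at_mid l1 l2 l3 : code_at (l1 ++ l2 ++ l3) (size l1) l2.
Proof.
by move=> j lt; rewrite nth_cat ltnNge leq_addr addKn nth_cat lt.
Qed.

Definition straight i := match i with IJz _ _ | IHalt => false | _ => true end.

Definition effect (m : nat -> nat) i : nat -> nat :=
  match i with
  | IConst d c => upd m d c
  | IAdd d a b => upd m d (m a + m b)
  | ISub d a b => upd m d (m a - m b)
  | IMul d a b => upd m d (m a * m b)
  | IDiv d a b => upd m d (m a %/ m b)
  | IMod d a b => upd m d (m a %% m b)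
  | ILoad d a => upd m d (m (m a))
  | IStore a s => upd m (m a) (m s)
  | _ => m
  end.

Definition effects := foldl effect.

Lemma steps_straight P o l m : all straight l -> code_at P o l ->
  steps P (size l) (o, m) (o + size l, effects m l).
Proof.
elim: l o m => [|i l IH] o m /=; first by rewrite addn0 => _ _; apply: steps0.
move=> /andP[si sl] h; rewrite -add1n addnA; apply: (steps_trans (s2 := (o.+1, effect m i))).
  apply: steps1; rewrite /=; have := h 0 isT; rewrite addn0 => -> /=.
  by case: i si {h}.
rewrite addn1; apply: IH => // j lt.
by have := h j.+1 lt; rewrite addnS.
Qed.

Lemma steps_jz P o m r t : code_at P o [:: IJz r t] ->
  steps P 1 (o, m) (if m r == 0 then t else o.+1, m).
Proof. by move=> h; apply: steps1; have := h 0 isT; rewrite addn0 /= => ->. Qed.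

Definition reg := seq nat.
Definition state := reg -> nat.

Variant binop := Add | Sub | Mul | Div | Mod.

Inductive expr := Reg of reg | Const of nat | Bin of binop & expr & expr.

Definition denote_op op := match op with
  | Add => addn | Sub => subn | Mul => muln | Div => divn | Mod => modn end.

Fixpoint eval x (s : state) := match x with
  | Reg r => s r
  | Const c => c
  | Bin op x1 x2 => denote_op op (eval x1 s) (eval x2 s)
  end.

(* Addresses below 10 are left to the code that reads the input. *)
Definition adr (r : reg) := (pickle r).*2 + 10.
Definition tmp k := k.*2 + 11.
Arguments adr : simpl never.
Arguments tmp : simpl never.

Lemma adr_inj : injective adr.
Proof. by move=> r r' h; apply: (pcan_inj pickleK); move: h; rewrite /adr; lia. Qed.
Lemma adr_tmp r k : (adr r == tmp k) = false.
Proof. by apply/eqP; rewrite /adr /tmp; lia. Qed.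
Lemma eq_tmp j k : (tmp j == tmp k) = (j == k).
Proof. by apply/eqP/eqP; rewrite /tmp; lia. Qed.

Definition instr_of_op op := match op with
  | Add => IAdd | Sub => ISub | Mul => IMul | Div => IDiv | Mod => IMod end.

(** The temporaries from [tmp k] on form a stack, with the result in [tmp k]. A register is copied
    by adding it to zero. *)
Fixpoint comp_expr x k := match x with
  | Reg r => [:: IConst (tmp k) 0; IAdd (tmp k) (adr r) (tmp k)]
  | Const c => [:: IConst (tmp k) c]
  | Bin op x1 x2 => comp_expr x1 k ++ comp_expr x2 k.+1 ++
                    [:: instr_of_op op (tmp k) (tmp k) (tmp k.+1)]
  end.

Definition represents (m : nat -> nat) (s : state) := forall r, m (adr r) = s r.

Lemma comp_expr_straight x k : all straight (comp_expr x k).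
Proof. by elim: x k => //= op x1 IH1 x2 IH2 k; rewrite !all_cat IH1 IH2; case: op. Qed.

(** The frame clause carries the induction: evaluating the right operand at level [k.+1] cannot
    disturb the left value kept in [tmp k]. *)
Lemma comp_expr_correct x k m s : represents m s ->
  effects m (comp_expr x k) (tmp k) = eval x s /\
  forall a, (forall j, k <= j -> a != tmp j) -> effects m (comp_expr x k) a = m a.
Proof.
rewrite /effects; elim: x k m => [r|c|op x1 IH1 x2 IH2] k m ms /=.
- split; first by rewrite /upd !eqxx adr_tmp addn0 ms.
  by move=> a ha; rewrite /upd (negPf (ha _ (leqnn k))).
- split; first by rewrite /upd eqxx.
  by move=> a ha; rewrite /upd (negPf (ha _ (leqnn k))).
rewrite !foldl_cat /=; have [e1 f1] := IH1 k m ms.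
have ms1 : represents (foldl effect m (comp_expr x1 k)) s.
  by move=> r; rewrite f1 // => j _; rewrite adr_tmp.
have [e2 f2] := IH2 k.+1 _ ms1.
have e1' : foldl effect (foldl effect m (comp_expr x1 k)) (comp_expr x2 k.+1) (tmp k) = eval x1 s.
  by rewrite f2 // => j lt; rewrite eq_tmp; lia.
split; first by case: op => /=; rewrite /upd eqxx e1' e2.
move=> a ha; have -> : effect (foldl effect (foldl effect m (comp_expr x1 k)) (comp_expr x2 k.+1))
    (instr_of_op op (tmp k) (tmp k) (tmp k.+1)) a =
    foldl effect (foldl effect m (comp_expr x1 k)) (comp_expr x2 k.+1) a.
  by case: op; rewrite /= /upd (negPf (ha _ (leqnn k))).
by rewrite f2 ?f1 // => j lt; apply: ha; apply: ltnW.
Qed.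

Inductive cmd := Skip | Asg of reg & expr | Seq of cmd & cmd | If of expr & cmd & cmd
  | Loop of reg & cmd.

Definition set_reg (s : state) r v : state := fun r' => if r' == r then v else s r'.

(** The last index is the exact number of machine steps of the compiled command, jumps included. A
    loop decrements its counter before the body, so the body sees the number of rounds still to
    come. *)
Inductive exec : cmd -> state -> state -> nat -> Prop :=
| ExecSkip s : exec Skip s s 0
| ExecAsg r x s : exec (Asg r x) s (set_reg s r (eval x s)) (size (comp_expr x 0) + 2)
| ExecSeq c1 c2 s1 s2 s3 k1 k2 :
    exec c1 s1 s2 k1 -> exec c2 s2 s3 k2 -> exec (Seq c1 c2) s1 s3 (k1 + k2)
| ExecIfT x c1 c2 s s' k : eval x s != 0 -> exec c1 s s' k ->
    exec (If x c1 c2) s s' (size (comp_expr x 0) + k + 3)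
| ExecIfF x c1 c2 s s' k : eval x s = 0 -> exec c2 s s' k ->
    exec (If x c1 c2) s s' (size (comp_expr x 0) + k + 1)
| ExecLoop0 r c s : s r = 0 -> exec (Loop r c) s s 1
| ExecLoopS r c s s1 s2 k1 k2 : s r != 0 -> exec c (set_reg s r (s r - 1)) s1 k1 ->
    exec (Loop r c) s1 s2 k2 -> exec (Loop r c) s s2 (k1 + k2 + 5).

(** Jumps are absolute, hence the load address [o]. Setting [tmp 0] to zero and then testing it is
    an unconditional jump. *)
Fixpoint comp o c : seq instr := match c with
  | Skip => [::]
  | Asg r x => comp_expr x 0 ++ [:: IConst (tmp 1) 0; IAdd (adr r) (tmp 0) (tmp 1)]
  | Seq c1 c2 => let l1 := comp o c1 in l1 ++ comp (o + size l1) c2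
  | If x c1 c2 =>
      let l0 := comp_expr x 0 in
      let l1 := comp (o + size l0 + 1) c1 in
      let o2 := o + size l0 + 1 + size l1 + 2 in
      let l2 := comp o2 c2 in
      l0 ++ [:: IJz (tmp 0) o2] ++ l1 ++ [:: IConst (tmp 0) 0; IJz (tmp 0) (o2 + size l2)] ++ l2
  | Loop r c =>
      let l := comp (o + 3) c in
      [:: IJz (adr r) (o + 3 + size l + 2); IConst (tmp 0) 1; ISub (adr r) (adr r) (tmp 0)] ++ l
      ++ [:: IConst (tmp 0) 0; IJz (tmp 0) o]
  end.

Lemma represents_tmp m s k v : represents m s -> represents (upd m (tmp k) v) s.
Proof. by move=> h r; rewrite /upd adr_tmp h. Qed.

Lemma represents_set m s r v : represents m s -> represents (upd m (adr r) v) (set_reg s r v).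
Proof. by move=> h r'; rewrite /upd /set_reg (inj_eq adr_inj); case: eqP. Qed.

Lemma represents_expr m s x k : represents m s -> represents (effects m (comp_expr x k)) s.
Proof.
move=> h r; have [_ ->] := comp_expr_correct x k h => //.
by move=> j _; rewrite adr_tmp.
Qed.

Lemma steps_expr P o x m s : represents m s -> code_at P o (comp_expr x 0) ->
  exists m', [/\ steps P (size (comp_expr x 0)) (o, m) (o + size (comp_expr x 0), m'),
                 represents m' s & m' (tmp 0) = eval x s].
Proof.
move=> ms h; exists (effects m (comp_expr x 0)); split.
- exact: steps_straight (comp_expr_straight _ _) h.
- exact: represents_expr.
- by have [] := comp_expr_correct x 0 ms.
Qed.

Lemma comp_correct c s s' k : exec c s s' k -> forall P o m,
  code_at P o (comp o c) -> represents m s ->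
  exists2 m', steps P k (o, m) (o + size (comp o c), m') & represents m' s'.
Proof.
elim=> {c s s' k} /=.
- by move=> s P o m _ ms; exists m => //; rewrite addn0; apply: steps0.
- move=> r x s P o m /code_at_cat[h1 h2] ms.
  have [m1 [s1 ms1 e1]] := steps_expr ms h1.
  exists (effects m1 [:: IConst (tmp 1) 0; IAdd (adr r) (tmp 0) (tmp 1)]).
    rewrite size_cat addnA; apply: steps_trans s1 _.
    exact: (steps_straight (l := [:: IConst (tmp 1) 0; IAdd (adr r) (tmp 0) (tmp 1)])).
  rewrite /effects /= [in X in upd _ _ X]/upd eqxx eq_tmp /= addn0 e1.
  exact/represents_set/represents_tmp.
- move=> c1 c2 s1 s2 s3 k1 k2 _ IH1 _ IH2 P o m /code_at_cat[h1 h2] ms1.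
  have [m2 st1 ms2] := IH1 _ _ _ h1 ms1; have [m3 st2 ms3] := IH2 _ _ _ h2 ms2.
  by exists m3 => //; rewrite size_cat addnA; apply: steps_trans st1 st2.
- move=> x c1 c2 s s' k xs _ IH P o m.
  set l0 := comp_expr x 0; set l1 := comp _ c1; set o2 := _ + 2; set l2 := comp o2 c2.
  move=> /code_at_cat[h0 /(@code_at_cat _ _ [:: _])[hj]] /code_at_cat[h1].
  move=> /(@code_at_cat _ _ [:: _; _])[h2 _] ms.
  have [m1 [st1 ms1 e1]] := steps_expr ms h0.
  have := steps_jz m1 hj; rewrite e1 (negPf xs) => st2.
  have [m2 st3 ms2] := IH _ _ _ h1 ms1.
  have [hc hz] := @code_at_cat _ _ [:: _] _ h2.
  have st4 := steps_straight (l := [:: IConst (tmp 0) 0]) m2 isT hc.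
  have := steps_jz (effects m2 [:: IConst (tmp 0) 0]) hz.
  rewrite /effects /= => st5.
 
  exists (upd m2 (tmp 0) 0); last exact: represents_tmp.
  rewrite size_cat /= size_cat /= -/l1.
  have -> : size l0 + k + 3 = size l0 + (1 + (k + (1 + 1))) by lia.
  have -> : o + (size l0 + (size l1 + (size l2).+2).+1) = o2 + size l2 by rewrite /o2; lia.
  rewrite -(addn1 (o + _)) in st2; apply: steps_trans st1 _; apply: steps_trans st2 _.
  apply: steps_trans st3 _; exact: steps_trans st4 st5.
- move=> x c1 c2 s s' k xs _ IH P o m.
  set l0 := comp_expr x 0; set l1 := comp _ c1; set o2 := _ + 2; set l2 := comp o2 c2.
  move=> /code_at_cat[h0 /(@code_at_cat _ _ [:: _])[hj]] /code_at_cat[_].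
  move=> /(@code_at_cat _ _ [:: _; _])[_ h2] ms.
  have [m1 [st1 ms1 e1]] := steps_expr ms h0.
  have := steps_jz m1 hj; rewrite e1 xs eqxx => st2.
  have [m2 st3 ms2] := IH _ _ _ h2 ms1.
  exists m2 => //; rewrite size_cat /= size_cat /= -/l1.
  have -> : size l0 + k + 1 = size l0 + (1 + k) by lia.
  have -> : o + (size l0 + (size l1 + (size l2).+2).+1) = o2 + size l2 by rewrite /o2; lia.
  by apply: steps_trans st1 _; apply: steps_trans st2 _; move: st3; rewrite /o2 -/l1.
- move=> r c s r0 P o m /(@code_at_cat _ _ [:: _])[hj _] ms; exists m => //.
  have := steps_jz m hj; rewrite ms r0 eqxx size_cat /=.
  by congr (steps _ _ _ (_, _)); lia.
- move=> r c s s1 s2 k1 k2 r0 _ IH1 _ IH2 P o m h ms.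
  have /(@code_at_cat _ _ [:: _])[hj /(@code_at_cat _ _ [:: _; _])[ha]] := h.
  rewrite -addnA => /code_at_cat[hb /(@code_at_cat _ _ [:: _])[hc hz]].
  have := steps_jz m hj; rewrite ms (negPf r0) => st1.
  have st2 := steps_straight (l := [:: IConst (tmp 0) 1; ISub (adr r) (adr r) (tmp 0)]) m isT ha.
  have ms2 : represents (effects m [:: IConst (tmp 0) 1; ISub (adr r) (adr r) (tmp 0)])
     (set_reg s r (s r - 1)).
    rewrite /effects /= [in X in upd _ _ X]/upd eqxx adr_tmp ms.
    exact/represents_set/represents_tmp.
  have [m3 st3 ms3] := IH1 _ _ _ hb ms2.
  have st4 := steps_straight (l := [:: IConst (tmp 0) 0]) m3 isT hc.
  have := steps_jz (effects m3 [:: IConst (tmp 0) 0]) hz.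
  rewrite /effects /= => st5.
  have [m4 st6 ms4] := IH2 _ _ _ h (represents_tmp 0 0 ms3).
  exists m4 => //.
  have -> : k1 + k2 + 5 = 1 + (2 + (k1 + (1 + (1 + k2)))) by lia.
  rewrite -(addn1 o) in st1; rewrite -(addnA o (size [:: _])) in st2.
  apply: steps_trans st1 _; apply: steps_trans st2 _.
  apply: steps_trans st3 _; apply: steps_trans st4 _.
  exact: steps_trans st5 st6.
Qed.

Fixpoint loopfree c := match c with
  | Seq c1 c2 => loopfree c1 && loopfree c2
  | If _ c1 c2 => loopfree c1 && loopfree c2
  | Loop _ _ => false
  | _ => true
  end.

(** The default branch gives [Loop] a dummy meaning; [exec_den] ties [den] to execution for
    loop-free commands. *)
Fixpoint den c s : state := match c with
  | Asg r x => set_reg s r (eval x s)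
  | Seq c1 c2 => den c2 (den c1 s)
  | If x c1 c2 => if eval x s == 0 then den c2 s else den c1 s
  | _ => s
  end.

Fixpoint cost c := match c with
  | Asg r x => size (comp_expr x 0) + 2
  | Seq c1 c2 => cost c1 + cost c2
  | If x c1 c2 => size (comp_expr x 0) + (cost c1 + cost c2) + 3
  | _ => 0
  end.

Fixpoint writes c : seq reg := match c with
  | Asg r x => [:: r]
  | Seq c1 c2 => writes c1 ++ writes c2
  | If x c1 c2 => writes c1 ++ writes c2
  | Loop r c => r :: writes c
  | _ => [::]
  end.

Lemma den_frame c r s : r \notin writes c -> den c s r = s r.
Proof.
elim: c s => //= [r' x|c1 IH1 c2 IH2|x c1 IH1 c2 IH2] s.
- by rewrite mem_seq1 /set_reg => /negPf ->.
- by rewrite mem_cat negb_or => /andP[h1 h2]; rewrite IH2 // IH1.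
- by rewrite mem_cat negb_or => /andP[h1 h2]; case: ifP; rewrite ?IH1 ?IH2.
Qed.

Lemma exec_den c s : loopfree c -> exists2 k, exec c s (den c s) k & k <= cost c.
Proof.
elim: c s => //= [s _|r x s _|c1 IH1 c2 IH2 s|x c1 IH1 c2 IH2 s].
- by exists 0 => //; constructor.
- by eexists; first constructor.
- move=> /andP[/(IH1 s)[k1 e1 l1] /(IH2 (den c1 s))[k2 e2 l2]].
  by exists (k1 + k2); [apply: ExecSeq e1 e2|apply: leq_add].
- move=> /andP[/(IH1 s)[k1 e1 l1] /(IH2 s)[k2 e2 l2]].
  case: eqP => [x0|/eqP x0].
    by eexists; [apply: ExecIfF x0 e2|lia].
  by eexists; [apply: ExecIfT x0 e1|lia].
Qed.

(** [Inv] is indexed by the number of rounds left. It must survive a change of the counter alone, as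
    the decrement happens outside the body. *)
Lemma exec_loop r c (Inv : nat -> state -> Prop) s : loopfree c -> r \notin writes c ->
  (forall k t v, Inv k t -> Inv k (set_reg t r v)) ->
  (forall k t, t r = k -> Inv k.+1 t -> Inv k (den c t)) ->
  Inv (s r) s ->
  exists s' k, [/\ exec (Loop r c) s s' k, Inv 0 s' & k <= s r * (cost c + 5) + 1].
Proof.
move=> lf nw frame step; move E: (s r) => k; elim: k s E => [|k IH] s rk h.
  by exists s, 1; split => //; apply: ExecLoop0.
set t := set_reg s r (s r - 1).
have tr : t r = k by rewrite /t /set_reg eqxx rk subn1.
have [k1 e1 l1] := exec_den t lf.
have [||s' [k2 [e2 h2 l2]]] := IH (den c t).
- by rewrite den_frame.
- by apply: step => //; apply: frame.
exists s', (k1 + k2 + 5); split => //; last by lia.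
by apply: ExecLoopS e1 e2; rewrite rk.
Qed.

End Compilation.

(** * Reading the input *)

Section Input.
Variable n : nat.
Implicit Types u v : seq (letter n).

(** Letter codes run from 1 to [2 * n]; the digit 0 stays free to mark the absence of a letter. *)
Definition radix := (2 * n).+1.
(** Most significant digit first, so the last letter read is the remainder modulo [radix]. The
    projections use the opposite order. *)
Definition num (D : seq nat) := foldl (fun X d => X * radix + d) 0 D.

Lemma code_lt (a : letter n) : code a < radix.
Proof. by rewrite /code /radix; have := ltn_ord a.1; case: a.2 => /=; lia. Qed.

Lemma code_inj : injective (@code n).
Proof.
move=> [x b] [y c] [] /= h.
have [xy ->] : x = y :> nat /\ b = c by move: h; case: b; case: c => /= h; split; lia.
by rewrite (ord_inj xy).
Qed.

Lemma num_rcons D d : num (rcons D d) = num D * radix + d.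
Proof. by rewrite /num -cats1 foldl_cat. Qed.

Lemma foldl_num X D : foldl (fun X d => X * radix + d) X D = X * radix ^ size D + num D.
Proof.
elim/last_ind: D => [|D d IH]; first by rewrite /= muln1 addn0.
by rewrite -cats1 foldl_cat /= IH cats1 num_rcons size_rcons expnSr mulnDl addnA mulnA.
Qed.

Lemma num_lt D : all (fun d => d < radix) D -> num D < radix ^ size D.
Proof.
elim/last_ind: D => [|D d IH]; first by [].
rewrite all_rcons num_rcons size_rcons expnSr => /andP[ld /IH h].
by apply: (@leq_trans ((num D).+1 * radix)); [rewrite mulSn; lia|rewrite leq_mul2r h orbT].
Qed.

Definition letter_at u v j := nth 0 (map (@code n) (u ++ v)) j.

Lemma ram_inputE u v j : (ram_input u v).2 (j + 2) = letter_at u v j.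
Proof.
rewrite /ram_input /letter_at /= map_cat nth_cat size_map addnK.
have -> : (j + 2 == 0) = false by lia.
have -> : (j + 2 == 1) = false by lia.
have -> : (j + 2 < 2 + size u) = (j < size u) by lia.
have -> : (j + 2 < 2 + size u + size v) = (j < size u + size v) by lia.
case: ltnP => lu; first by case: u lu => // a u lu; rewrite (nth_map a).
case: ltnP => lv; last by rewrite nth_default // size_map; lia.
case: v lv => [|a v] lv; first by move: lv; rewrite addn0; lia.
by rewrite (nth_map a) // ltn_subLR.
Qed.

Lemma letter_at_lt u v j : letter_at u v j < radix.
Proof.
rewrite /letter_at; case: (ltnP j (size (map (@code n) (u ++ v)))) => h.
  by have /mapP[a _ ->] := mem_nth 0 h; apply: code_lt.
by rewrite nth_default.
Qed.

Definition rX : reg := [:: 0].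
Definition rU : reg := [:: 1].
Definition rT : reg := [:: 2].

(* The first seven letters, if any, are packed into register 0 to free the registers
   with fixed addresses; the loop at 22 then appends the other letters up to the
   first zero.  The packed number is a sequence of digits, with trailing zeros
   when the input has fewer than seven letters. *)
Definition pack : seq instr :=
  IConst 1 radix :: flatten [seq [:: IMul 0 0 1; IAdd 0 0 j] | j <- iota 2 7] ++
  [:: IConst 2 (radix ^ 7); IDiv 3 0 2; IMod 0 0 2; IConst 4 7; IConst 5 9; IConst 6 1; IConst 7 0].
Definition append : seq instr :=
  [:: ILoad 8 5; IJz 8 29; IMul 0 0 1; IAdd 0 0 8; IAdd 4 4 6; IAdd 5 5 6; IJz 7 22].
(** Register 7 holds zero at this point, so the additions are copies. *)
Definition transfer : seq instr :=
  [:: IAdd (adr rX) 0 7; IAdd (adr rU) 3 7; IAdd (adr rT) 4 7].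

(** Register 0 starts with the length of the first word, which thus becomes the leading part of the
    packed number: dividing by [radix ^ 7] recovers it. The length of the second word is
    overwritten, as the first zero cell marks the end of the input. *)
Lemma pack_effect m : 
  let X := foldl (fun X d => X * radix + d) (m 0) [seq m (j + 2) | j <- iota 0 7] in
  let m' := effects m pack in
  [/\ m' 0 = X %% radix ^ 7, m' 3 = X %/ radix ^ 7 & [/\ m' 1 = radix, m' 4 = 7, m' 5 = 9, m' 6 = 1 & m' 7 = 0]]
  /\ forall a, 9 <= a -> m' a = m a.
Proof.
split; first by split.
by do 9 (case=> //).
Qed.

Variables (P : program) (u v : seq (letter n)).
Hypothesis P_pack : code_at P 0 pack.
Hypothesis P_append : code_at P 22 append.
Hypothesis P_transfer : code_at P 29 transfer.

Definition reading i (m : nat -> nat) :=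
  [/\ m 0 = num (mkseq (letter_at u v) i), m 3 = size u &
   [/\ m 1 = radix, m 4 = i, m 5 = i + 2, m 6 = 1 & m 7 = 0]] /\
  forall a, 9 <= a -> m a = (ram_input u v).2 a.

Lemma steps_pack : exists2 m, steps P 22 (ram_input u v) (22, m) & reading 7 m.
Proof.
have st := steps_straight (ram_input u v).2 (isT : all straight pack) P_pack.
exists (effects (ram_input u v).2 pack); first exact: st.
have [[e0 e3 e] fr] := pack_effect (ram_input u v).2; split; last exact: fr.
have Em : [seq (ram_input u v).2 (j + 2) | j <- iota 0 7] = mkseq (letter_at u v) 7.
  by apply: eq_map => j; apply: ram_inputE.
have lt : num (mkseq (letter_at u v) 7) < radix ^ 7.
  have := @num_lt (mkseq (letter_at u v) 7); rewrite size_mkseq; apply.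
  by apply/allP => _ /mapP[j _ ->]; apply: letter_at_lt.
have r0 : 0 < radix ^ 7 by rewrite expn_gt0.
move: e0 e3; rewrite Em foldl_num size_mkseq => -> ->; split => //.
  by rewrite modnMDl modn_small.
by rewrite divnMDl // divn_small // addn0.
Qed.

(** Codes are positive, so the loop cannot stop inside the input. The number [T] of digits exceeds
    the number of letters only if [i] already does, which happens for inputs shorter than seven. *)
Lemma steps_append i m : 7 <= i -> reading i m ->
  exists m' k T, [/\ steps P k (22, m) (29, m'), reading T m' &
    [/\ size u + size v <= T, T <= maxn i (size u + size v) & k <= 7 * (size u + size v - i) + 2]].
Proof.
have [d] := ubnP (size u + size v - i); elim: d => // d IH in i m * => lt le7 hm.
have [[h0 h3 [h1 h4 h5 h6 h7]] fr] := hm.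
have [] := @code_at_cat P 22 (take 1 append) (drop 1 append); first by rewrite cat_take_drop.
rewrite addn1 => cL cR.
have := steps_straight m (isT : all straight (take 1 append)) cL; rewrite addn1 => st1.
have [cJ cR1] := @code_at_cat P 23 (take 1 (drop 1 append)) (drop 2 append) cR.
have := steps_jz (effects m (take 1 append)) cJ.
have E8 : effects m (take 1 append) 8 = letter_at u v i.
  by rewrite /effects /= /upd /= h5 fr ?ram_inputE //; lia.
rewrite E8; case: eqP => [l0|/eqP l0] st2.
  exists (effects m (take 1 append)), (1 + 1), i; split.
  - exact: steps_trans st1 st2.
  - split => //; case=> [//|]; do 8 (case=> //); move=> a; exact: fr.
  - split; last by rewrite leq_addl.
    + rewrite leqNgt; apply/negP => li; move/eqP: l0; apply/negP.
      have lj : i < size (map (@code n) (u ++ v)) by rewrite size_map size_cat.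
      by have /mapP[a _] := mem_nth 0 lj; rewrite /letter_at => ->.
    + by rewrite leq_max leqnn.
have li : i < size u + size v.
  by rewrite ltnNge; apply: contra l0 => le; rewrite /letter_at nth_default // size_map size_cat.
have [cB cZ] := @code_at_cat P 24 (take 4 (drop 2 append)) (drop 6 append) cR1.
set m1 := effects m (take 1 append) in st1 st2 E8.
have st3 := steps_straight m1 (isT : all straight (take 4 (drop 2 append))) cB.
set m2 := effects m1 (take 4 (drop 2 append)) in st3.
have st4 := steps_jz m2 cZ.
have z2 : m2 7 == 0 by rewrite /m2 /m1 /effects /= /upd /= h7.
rewrite z2 in st4.
have [|||m' [k [T [st5 hm' [h8 h9 h10]]]]] := IH i.+1 m2.
- by lia.
- by lia.
- split; last by case=> [//|]; do 8 (case=> //); move=> a; apply: fr.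
  split; rewrite ?/m2 ?/m1 /effects /= /upd /= ?h0 ?h1 ?h3 ?h4 ?h5 ?h6 ?h7.
  + by rewrite fr ?ram_inputE; [rewrite mkseqS num_rcons|lia].
  + by [].
  + by split => //; lia.
exists m', (1 + (1 + (4 + (1 + k)))), T; split => //.
  apply: steps_trans st1 _; apply: steps_trans st2 _; apply: steps_trans st3 _.
  exact: steps_trans st4 st5.
by split => //; [move: h9; rewrite !leq_max; lia|lia].
Qed.

Lemma steps_read : exists m k T,
  [/\ steps P k (ram_input u v) (32, m),
      [/\ m (adr rX) = num (mkseq (letter_at u v) T), m (adr rU) = size u & m (adr rT) = T] &
      [/\ size u + size v <= T, T <= size u + size v + 7 & k <= 7 * (size u + size v) + 27]].
Proof.
have [m1 st1 h1] := steps_pack.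
have [//|m2 [k [T [st2 [[h0 h3 [_ h4 _ _ h7]] _] [l1 l2 l3]]]]] := steps_append _ h1.
have st3 := steps_straight m2 (isT : all straight transfer) P_transfer.
have ad r : [/\ (0 == adr r) = false, (3 == adr r) = false, (4 == adr r) = false & (7 == adr r) = false].
  by split; apply/eqP; rewrite /adr; lia.
exists (effects m2 transfer), (22 + (k + 3)), T; split.
- by apply: steps_trans st1 _; apply: steps_trans st2 st3.
- have [x0 x3 x4 x7] := ad rX; have [u0 u3 u4 u7] := ad rU.
  by rewrite /effects /= /upd !(inj_eq adr_inj) /= ?x0 ?x3 ?x4 ?x7 ?u0 ?u3 ?u4 ?u7 h0 h3 h4 h7 !addn0.
- by split => //; [move: l2; rewrite leq_max; lia|lia].
Qed.

End Input.

(** * Traces *)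

Section Traces.
Variables (n : nat) (e : rel 'I_n).
Implicit Types (a b c : letter n) (u v w : seq (letter n)) (p : 'I_n * 'I_n).

Definition meets a p := (a.1 == p.1) || (a.1 == p.2).
Definition pr p w := [seq a <- w | meets a p].
(** With [e] irreflexive, diagonal pairs are included; their projections make the multiset of
    letters an invariant. *)
Definition teq u v := forall p, ~~ e p.1 p.2 -> pr p u = pr p v.
Local Notation "u =t v" := (teq u v) (at level 70).

Lemma pr_cat p u v : pr p (u ++ v) = pr p u ++ pr p v.
Proof. exact: filter_cat. Qed.

Lemma pr_cons p a u : pr p (a :: u) = if meets a p then a :: pr p u else pr p u.
Proof. by []. Qed.

Lemma teq_sym u v : u =t v -> v =t u. Proof. by move=> h p /h ->. Qed.
Lemma teq_trans v u w : u =t v -> v =t w -> u =t w.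
Proof. by move=> h1 h2 p np; rewrite h1 ?h2. Qed.

Lemma teq_cat u v u' v' : u =t u' -> v =t v' -> u ++ v =t u' ++ v'.
Proof. by move=> h1 h2 p np; rewrite !pr_cat h1 ?h2. Qed.
Lemma teq_catl s u v : u =t v -> s ++ u =t s ++ v.
Proof. exact: teq_cat. Qed.
Lemma teq_catr s u v : u =t v -> u ++ s =t v ++ s.
Proof. by move=> h; apply: teq_cat. Qed.
Lemma teq_cons a u v : u =t v -> a :: u =t a :: v.
Proof. exact: (@teq_catl [:: a]). Qed.

Lemma teq_catl_inj s u v : s ++ u =t s ++ v -> u =t v.
Proof.
move=> h p /h; rewrite !pr_cat => /eqP; rewrite eqseq_cat // => /andP[_] /eqP //.
Qed.
Lemma teq_cons_inj a u v : a :: u =t a :: v -> u =t v.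
Proof. exact: (@teq_catl_inj [:: a]). Qed.

Lemma teq_rev u v : u =t v -> rev u =t rev v.
Proof. by move=> h p np; rewrite /pr !filter_rev; congr rev; apply: h. Qed.
Lemma teq_revE u v : rev u =t rev v -> u =t v.
Proof. by move/teq_rev; rewrite !revK. Qed.

Lemma teq_catr_inj s u v : u ++ s =t v ++ s -> u =t v.
Proof. by move/teq_rev; rewrite !rev_cat => /teq_catl_inj /teq_revE. Qed.

Hypothesis e_irr : irreflexive e.
Hypothesis e_sym : symmetric e.

Lemma teq_perm u v : u =t v -> perm_eq u v.
Proof.
move=> h; apply/allP => a _; apply/eqP.
have E w : count_mem a w = count_mem a (pr (a.1, a.1) w).
  rewrite /pr count_filter; apply: eq_count => b /=.
  by case: eqP => // ->; rewrite /meets eqxx.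
by rewrite (E u) (E v) h //= e_irr.
Qed.

Lemma teq_size u v : u =t v -> size u = size v.
Proof. by move/teq_perm/perm_size. Qed.

Lemma teq_swap a b : e a.1 b.1 -> [:: a; b] =t [:: b; a].
Proof.
move=> eab p np; rewrite /pr /=.
case ha: (meets a p); case hb: (meets b p) => //.
by move: eab np; case/orP: ha => /eqP->; case/orP: hb => /eqP->;
  rewrite ?e_irr // e_sym => ->.
Qed.

Lemma teq_move a s : all (fun c => e a.1 c.1) s -> s ++ [:: a] =t a :: s.
Proof.
elim: s => [|c s IH] //= /andP[eac /IH h].
apply: (@teq_trans (c :: a :: s)); first exact: teq_cons.
by apply: (@teq_catr s [:: c; a] [:: a; c]); apply: teq_swap; rewrite e_sym.
Qed.

Lemma teq_merge b s1 s2 : all (fun c => e b.1 c.1) s1 ->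
  s1 ++ b :: s2 =t b :: s1 ++ s2.
Proof.
move=> h; rewrite -cat1s catA -[b :: s1 ++ s2]cat_cons; apply: teq_catr.
exact: teq_move.
Qed.

(** Take the first letter of [s] at the vertex of [b]. The diagonal projection shows that it is [b],
    and a noncommuting letter before it would head a projection that has to start with [b]. *)
Lemma teq_split b s y : s =t b :: y ->
  exists s1 s2, [/\ s = s1 ++ b :: s2, all (fun c => e b.1 c.1) s1 & y =t s1 ++ s2].
Proof.
move=> h.
have hb : has (fun c => c.1 == b.1) s.
  have : b \in s by rewrite (perm_mem (teq_perm h)) mem_head.
  by move=> bs; apply/hasP; exists b.
case/split_find: hb h => b' s1 s2 /= /eqP eb' /hasPn ns1; rewrite cat_rcons => h.
have nin c : c \in s1 -> c.1 != b.1 by apply: ns1.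
have E0 : pr (b.1, b.1) s1 = [::].
  apply/eqP; rewrite -[_ == _]negbK -has_filter; apply/hasPn => c /nin.
  by rewrite /meets orbb.
have eb : b' = b.
  have := h (b.1, b.1); rewrite /= e_irr => /(_ isT).
  by rewrite pr_cat E0 !pr_cons /meets eb' /= eqxx /= => -[].
subst b'.
have hs1 : all (fun c => e b.1 c.1) s1.
  apply/allP => c cs1; apply: contraT => nec.
  have := h (b.1, c.1) nec; rewrite pr_cat [in RHS]pr_cons /meets eqxx /=.
  case E: (pr (b.1, c.1) s1) => [|d r] /=.
    have : c \in pr (b.1, c.1) s1 by rewrite mem_filter /meets eqxx orbT.
    by rewrite E.
  move=> [ed _]; have : d \in pr (b.1, c.1) s1 by rewrite E mem_head.
  by rewrite mem_filter => /andP[_ /nin]; rewrite ed eqxx.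
exists s1, s2; split => //; apply: (@teq_cons_inj b).
exact: teq_trans (teq_sym h) (teq_merge _ hs1).
Qed.

Lemma levi a b x y : a :: x =t b :: y -> a != b ->
  e a.1 b.1 /\ exists z, x =t b :: z /\ y =t a :: z.
Proof.
move=> h ab; case: (teq_split h) => [[|c s1] [s2 [/= []]]].
  by move=> eab; rewrite eab eqxx in ab.
move=> <- -> /andP[eba hs] hy; split; first by rewrite e_sym.
by exists (s1 ++ s2); split => //; apply: teq_merge.
Qed.

Lemma levi_r a b x y : x ++ [:: a] =t y ++ [:: b] -> a != b ->
  e a.1 b.1 /\ exists z, x =t z ++ [:: b] /\ y =t z ++ [:: a].
Proof.
move/teq_rev; rewrite !rev_cat => h /(levi h)[eab [z [hx hy]]]; split => //.
by exists (rev z); split; apply: teq_revE; rewrite rev_cat revK.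
Qed.

(** Either the first and the last letter are different occurrences, or they are the same one, which
    then commutes with all the rest. *)
Lemma levi_mixed a b x y : a :: x =t y ++ [:: b] ->
  (exists z, x =t z ++ [:: b] /\ y =t a :: z) \/
  [/\ x =t y, a = b & all (fun c => e a.1 c.1) y].
Proof.
move/teq_sym => h; case: (teq_split h) => [s1 [s2 []]].
case/lastP: s2 => [|s2 c].
  rewrite !cats1 cats0 => /rcons_inj[-> ->] hy hx.
  by right; split.
rewrite cats1 -rcons_cons -rcons_cat => /rcons_inj[-> ->] hs hx.
left; exists (s1 ++ s2); split; first by rewrite -catA cats1.
exact: teq_merge.
Qed.

Lemma pr_nil_allP p w : (pr p w == [::]) = ~~ has (fun a => meets a p) w.
Proof. by rewrite has_filter negbK. Qed.

Definition pairs a : seq ('I_n * 'I_n) :=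
  [seq p <- enum {: 'I_n * 'I_n} | ~~ e p.1 p.2 && meets a p].

Lemma mem_pairs a p : (p \in pairs a) = ~~ e p.1 p.2 && meets a p.
Proof. by rewrite mem_filter mem_enum andbT. Qed.

Definition ldesc a w := all (fun p => ohead (pr p w) == Some a) (pairs a).

Lemma ldesc_cons a w h : w =t a :: h -> ldesc a w.
Proof.
move=> hw; apply/allP => p; rewrite mem_pairs => /andP[np ap].
by rewrite hw // pr_cons ap.
Qed.

(** A letter in front of the first [a] that did not commute with it would head their common
    projection in place of [a]. *)
Lemma ldescP a w : ldesc a w -> w =t a :: rem a w.
Proof.
move=> /allP h.
have fstP p : ~~ e p.1 p.2 -> meets a p -> ohead (pr p w) = Some a.
  by move=> np ap; apply/eqP/h; rewrite mem_pairs np.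
have aw : a \in w.
  have := fstP (a.1, a.1); rewrite /meets /= eqxx e_irr => /(_ isT isT).
  case E : (pr _ w) => [|c r] //= [ca]; have : a \in pr (a.1, a.1) w by rewrite E ca mem_head.
  by rewrite mem_filter => /andP[].
case/splitPr: aw fstP => {h} s1 s2.
elim: s1 => [|c s1 IH] fstP /=; first by rewrite eqxx.
case: (eqVneq c a) => [->|ca].
  exact: teq_cons.
have eac : e a.1 c.1.
  apply: contraT => nec; have := fstP (a.1, c.1) nec.
  by rewrite pr_cons /meets /= !eqxx orbT => /(_ isT) [] /eqP; rewrite (negPf ca).
apply: (@teq_trans (c :: a :: rem a (s1 ++ a :: s2))).
  apply: teq_cons; apply: IH => p np ap.
  have := fstP p np ap; rewrite pr_cons ifN //.
  apply: contraL eac => cp; move: np.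
  by case/orP: ap => /eqP->; case/orP: cp => /eqP->; rewrite ?e_irr // e_sym.
by apply: (@teq_catr _ [:: c; a] [:: a; c]); apply: teq_swap; rewrite e_sym.
Qed.

(** Prefixes can be recognised projection by projection: the first letter of [u] heads every
    projection of [v] that it meets, so it is a left descent and can be cancelled. *)
Lemma pr_pairs_teq u v :
  (forall p, ~~ e p.1 p.2 -> exists s, pr p v = pr p u ++ s) -> exists t, v =t u ++ t.
Proof.
elim: u v => [|a u IH] v h; first by exists v.
have /ldescP hv : ldesc a v.
  apply/allP => p; rewrite mem_pairs => /andP[np ap].
  by have [s ->] := h p np; rewrite pr_cons ap.
case: (IH (rem a v)) => [p np|t ht].
  have [s] := h p np; rewrite (hv p np) !pr_cons; case: (meets a p) => hs; exists s => //.
  by case: hs.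
by exists t; apply: teq_trans hv _; apply: teq_cons.
Qed.

(** * Normal forms in the right-angled Artin group *)

Lemma linvK : involutive (@linv n).
Proof. by case=> x b; rewrite /linv /= negbK. Qed.

Lemma raag_refl u : raag_eq e u u. Proof. exact: rst_refl. Qed.
Lemma raag_sym u v : raag_eq e u v -> raag_eq e v u. Proof. exact: rst_sym. Qed.
Lemma raag_trans v u w : raag_eq e u v -> raag_eq e v w -> raag_eq e u w.
Proof. exact: rst_trans. Qed.

Lemma raag_ctx s t u v : raag_eq e u v -> raag_eq e (s ++ u ++ t) (s ++ v ++ t).
Proof.
elim=> [x y|x|x y _|x y z _ h1 _ h2]; last 3 first.
- exact: raag_refl.
- exact: raag_sym.
- exact: raag_trans h1 h2.
case=> [s1 s2 a|s1 s2 a b eab]; apply: rst_step.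
  have := RS_cancel e (s ++ s1) (s2 ++ t) a; rewrite -!catA /=.
  by apply.
have := RS_comm (s ++ s1) (s2 ++ t) eab; rewrite -!catA /=.
by apply.
Qed.

Lemma raag_cat u u' v v' : raag_eq e u u' -> raag_eq e v v' ->
  raag_eq e (u ++ v) (u' ++ v').
Proof.
move=> /(raag_ctx [::] v) h1 /(raag_ctx u' [::]) h2.
by apply: raag_trans h1 _; rewrite !cats0 in h2.
Qed.
Lemma raag_catl s u v : raag_eq e u v -> raag_eq e (s ++ u) (s ++ v).
Proof. by apply: raag_cat; apply: raag_refl. Qed.
Lemma raag_catr s u v : raag_eq e u v -> raag_eq e (u ++ s) (v ++ s).
Proof. by move=> h; apply: raag_cat => //; apply: raag_refl. Qed.
Lemma raag_cons a u v : raag_eq e u v -> raag_eq e (a :: u) (a :: v).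
Proof. exact: (@raag_catl [:: a]). Qed.

Lemma raag_cancel a u : raag_eq e (a :: linv a :: u) u.
Proof. exact: rst_step (RS_cancel e [::] u a). Qed.

Lemma raag_cancelV a u : raag_eq e (linv a :: a :: u) u.
Proof. by have := raag_cancel (linv a) u; rewrite linvK. Qed.

Lemma raag_move b s1 s2 : all (fun c => e b.1 c.1) s1 ->
  raag_eq e (s1 ++ b :: s2) (b :: s1 ++ s2).
Proof.
elim: s1 => [|c s1 IH] /=; first by move=> _; apply: raag_refl.
move=> /andP[ebc /IH h]; apply: raag_trans (raag_cons c h) _.
by apply: rst_step; rewrite e_sym in ebc; exact: (RS_comm [::] (s1 ++ s2) ebc).
Qed.

Lemma teq_raag u v : u =t v -> raag_eq e u v.
Proof.
elim: v u => [|b v IH] u h; first by rewrite (size0nil (teq_size h)); apply: raag_refl.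
have [s1 [s2 [-> hs hv]]] := teq_split h.
by apply: raag_trans (raag_move s2 hs) _; apply/raag_cons/IH/teq_sym.
Qed.

Definition reduced w := forall x y a, ~ w =t x ++ a :: linv a :: y.

Lemma reduced_teq u v : u =t v -> reduced u -> reduced v.
Proof. by move=> h r x y a h'; apply: (r x y a); apply: teq_trans h'. Qed.

Lemma reduced_infix s t u : reduced (s ++ u ++ t) -> reduced u.
Proof.
move=> r x y a h; apply: (r (s ++ x) (y ++ t) a).
by rewrite -catA; apply: teq_catl; rewrite -!cat_cons catA; apply: teq_catr.
Qed.

Lemma reduced_behead a u : reduced (a :: u) -> reduced u.
Proof. by have := @reduced_infix [:: a] [::] u; rewrite cats0. Qed.

Lemma reduced_belast a u : reduced (u ++ [:: a]) -> reduced u.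
Proof. exact: (@reduced_infix [::] [:: a] u). Qed.

Lemma reduced_nil : reduced [::].
Proof. by move=> x y a /teq_size; rewrite size_cat /= addnS. Qed.

Lemma teq_swap2 a b w : e a.1 b.1 -> a :: b :: w =t b :: a :: w.
Proof. by move=> h; apply: (@teq_catr w [:: a; b] [:: b; a]); apply: teq_swap. Qed.

(** Levi's lemma strips the letters of [x] until the cancelling pair stands in front. If the pair
    does not use the new [a], it already cancels in [u]. *)
Lemma reduced_cons a u : reduced u -> ~ (exists h, u =t linv a :: h) -> reduced (a :: u).
Proof.
move=> ru na x y b; elim: x u ru na => [|c x IH] u ru na /= h.
  case: (eqVneq a b) na h => [->|ab] na h.
    by apply: na; exists y; apply: teq_cons_inj h.
  have [eab [z [hu hz]]] := levi h ab.
  case: (eqVneq (linv b) a) => [ba|ba].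
    by move: eab; rewrite -ba e_irr.
  have [_ [z' [_ hz']]] := levi hz ba.
  by apply: (ru [::] z' b); apply: teq_trans hu _; apply: teq_cons.
case: (eqVneq a c) h => [->|ac] h; first exact: (ru x y b (teq_cons_inj h)).
have [eac [z [hu hz]]] := levi h ac.
apply: (IH z); last exact: teq_sym.
  exact: (reduced_behead (reduced_teq hu ru)).
move=> [t ht]; apply: na; exists (c :: t); apply: teq_trans hu _.
by apply: teq_trans (teq_cons c ht) _; apply: teq_swap2; rewrite e_sym.
Qed.

Definition mull a w := if ldesc (linv a) w then rem (linv a) w else a :: w.
Definition nf w := foldr mull [::] w.

Variant mull_spec a w : seq (letter n) -> Prop :=
| MullPop h : w =t linv a :: h -> mull_spec a w h
| MullPush : ~ (exists h, w =t linv a :: h) -> mull_spec a w (a :: w).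

Lemma mullP a w : mull_spec a w (mull a w).
Proof.
rewrite /mull; case: ifP => h; first by constructor; apply: ldescP.
by constructor => -[t /ldesc_cons]; rewrite h.
Qed.

Lemma mull_raag a w : raag_eq e (mull a w) (a :: w).
Proof.
case: mullP => [h hw|_]; last exact: raag_refl.
apply: raag_sym; apply: raag_trans (raag_cons a (teq_raag hw)) _.
exact: raag_cancel.
Qed.

Lemma nf_raag w : raag_eq e (nf w) w.
Proof.
elim: w => [|a w IH]; first exact: raag_refl.
by apply: raag_trans (mull_raag _ _) _; apply: raag_cons.
Qed.

Lemma mull_reduced a w : reduced w -> reduced (mull a w).
Proof.
by case: mullP => [h hw|na] r; [apply: reduced_behead (reduced_teq hw r)|apply: reduced_cons].
Qed.

Lemma nf_reduced w : reduced (nf w).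
Proof. by elim: w => [|a w IH]; [apply: reduced_nil|apply: mull_reduced]. Qed.

Lemma mull_teq a u v : u =t v -> mull a u =t mull a v.
Proof.
move=> uv; case: mullP => [h hu|nu]; case: mullP => [h' hv|nv].
- apply: (@teq_cons_inj (linv a)); apply: teq_trans (teq_sym hu) _.
  exact: teq_trans hv.
- by case: nv; exists h; apply: teq_trans hu; apply: teq_sym.
- by case: nu; exists h'; apply: teq_trans hv.
- exact: teq_cons.
Qed.

Lemma mull_push a u : ~ (exists h, u =t linv a :: h) -> mull a u = a :: u.
Proof. by case: mullP => // h hu []; exists h. Qed.
Lemma mull_pop a u h : u =t linv a :: h -> mull a u =t h.
Proof.
move=> hu; case: mullP => [h' hu'|[]]; last by exists h.
by apply: (@teq_cons_inj (linv a)); apply: teq_trans hu; apply: teq_sym.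
Qed.

Lemma mullK a w : reduced w -> mull a (mull (linv a) w) =t w.
Proof.
move=> rw; case: (mullP (linv a) w) => [h hw|_].
  rewrite linvK in hw; rewrite mull_push; first exact: teq_sym.
  by move=> [t ht]; apply: (rw [::] t a); apply: teq_trans hw _; apply: teq_cons.
exact: mull_pop.
Qed.

Lemma mullC_pop a b r r1 : e a.1 b.1 -> r =t linv a :: r1 ->
  mull b r =t linv a :: mull b r1.
Proof.
move=> eab hr.
have ne c : e a.1 c.1 -> linv a != c by apply: contraTneq => <-; rewrite e_irr.
case: (mullP b r1) => [h hr1|nr1].
  apply: mull_pop; apply: teq_trans hr _.
  by apply: teq_trans (teq_cons _ hr1) _; apply: teq_swap2.
rewrite mull_push; first by apply: teq_trans (teq_cons _ hr) _; apply: teq_swap2; rewrite e_sym.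
move=> [h hr']; have := teq_trans (teq_sym hr) hr' => /levi[|_ [z [hz _]]].
  exact: ne.
by apply: nr1; exists z.
Qed.

Lemma mullC a b r : e a.1 b.1 -> mull a (mull b r) =t mull b (mull a r).
Proof.
move=> eab; have eba : e b.1 a.1 by rewrite e_sym.
have ne : linv a != b by apply: contraTneq eab => <-; rewrite e_irr.
case: (mullP a r) => [r1 hr|na].
  by apply: mull_pop; apply: mullC_pop.
case: (mullP b r) => [r2 hr|nb].
  by apply: teq_sym; apply: mull_pop; rewrite -(mull_push na); apply: mullC_pop.
rewrite !mull_push; first exact: teq_swap2.
- move=> [h hr]; have [|_ [z [hz _]]] := levi hr; last by apply: nb; exists z.
  by rewrite eq_sym; apply: contraTneq eab => <-; rewrite e_irr.
- move=> [h hr]; have [|_ [z [hz _]]] := levi hr; last by apply: na; exists z.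
  by rewrite eq_sym.
Qed.

Lemma nf_cat u v : nf (u ++ v) = foldr mull (nf v) u.
Proof. exact: foldr_cat. Qed.

Lemma foldr_mull_teq s u v : u =t v -> foldr mull u s =t foldr mull v s.
Proof. by move=> h; elim: s => //= a s; apply: mull_teq. Qed.

(** Van der Waerden's trick: the maps [mull a] satisfy the defining relations on reduced traces, so
    the group acts on these and [nf] is the orbit map of the empty trace. *)
Lemma raag_nf u v : raag_eq e u v -> nf u =t nf v.
Proof.
elim=> [x y|//|x y _ /teq_sym //|x y z _ h1 _ h2]; last exact: teq_trans h1 h2.
case=> [s1 s2 a|s1 s2 a b eab]; rewrite !nf_cat; apply: foldr_mull_teq => /=.
  by apply: mullK; apply: nf_reduced.
exact: mullC.
Qed.

Lemma nf_id u : reduced u -> nf u =t u.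
Proof.
elim: u => //= a u IH r; have hu := IH (reduced_behead r).
apply: teq_trans (mull_teq a hu) _; rewrite mull_push // => -[h hh].
by apply: (r [::] h a); apply: teq_cons.
Qed.

Lemma raag_teq u v : reduced u -> reduced v -> raag_eq e u v -> u =t v.
Proof.
move=> ru rv /raag_nf h; apply: teq_trans (teq_sym (nf_id ru)) _.
exact: teq_trans h (nf_id rv).
Qed.

(** * Twisted conjugacy by shrinking and rotating *)

Variable xs : seq 'I_n.
Notation phi := (phi_letter xs).

Lemma phi_letterE a : phi a = (a.1, a.2 (+) odd (count_mem a.1 xs)).
Proof.
rewrite /phi_letter; elim: xs => [|x s IH] /=; first by rewrite addbF; case: a.
rewrite {}IH /inversion /= oddD; case: eqVneq => [->|//] /=.
by rewrite /linv /= -addbT -addbA addbT.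
Qed.

Lemma phi1 a : (phi a).1 = a.1. Proof. by rewrite phi_letterE. Qed.
Lemma phiK : involutive phi.
Proof. by move=> [x s]; rewrite !phi_letterE /= addbK. Qed.
Lemma phi_linv a : phi (linv a) = linv (phi a).
Proof. by rewrite !phi_letterE /linv /= addNb. Qed.
Lemma phi_neq a b : a != b -> phi a != phi b.
Proof. by rewrite (inj_eq (inv_inj phiK)). Qed.
Lemma linv_inj a b : (linv a == linv b) = (a == b).
Proof. exact: (inj_eq (inv_inj linvK)). Qed.

Lemma pr_phi p w : pr p (map phi w) = map phi (pr p w).
Proof. by rewrite /pr filter_map; congr map; apply: eq_filter => a; rewrite /= /meets phi1. Qed.

Lemma teq_phi u v : u =t v -> map phi u =t map phi v.
Proof. by move=> h p np; rewrite !pr_phi h. Qed.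

Lemma reduced_rev w : reduced w -> reduced (rev w).
Proof.
move=> r x y a h; apply: (r (rev y) (rev x) (linv a)).
apply: teq_revE; apply: teq_trans h _.
by rewrite rev_cat !rev_cons !revK -!cats1 linvK -!catA.
Qed.

Lemma reduced_rcons a u : reduced u -> ~ (exists h, u =t h ++ [:: linv a]) -> reduced (u ++ [:: a]).
Proof.
move=> ru na; rewrite -[u ++ _]revK rev_cat; apply/reduced_rev/reduced_cons.
  exact: reduced_rev.
move=> [h /teq_rev]; rewrite revK => hu; apply: na; exists (rev h).
by rewrite rev_cons -cats1 in hu.
Qed.

(* A cancellation at the two ends of the cyclic word, and a rotation of it
   (the letter leaving at the left comes back at the right through [phi]). *)
Definition shrink g h := reduced g /\ exists a, g =t phi a :: h ++ [:: linv a].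
Definition rotate g h := exists a k, g =t a :: k /\ h =t k ++ [:: phi a].
(** Trace equality is included because words stand for traces, and reducedness because a rotation
    can create a cancellation. *)
Definition slide g h := [/\ reduced g, reduced h & [\/ g =t h, rotate g h | rotate h g]].

Lemma shrink_reduced g h : shrink g h -> reduced h.
Proof. by case=> r [a hg]; apply: reduced_belast (reduced_behead (reduced_teq hg r)). Qed.
Lemma shrink_size g h : shrink g h -> size h < size g.
Proof. by case=> r [a /teq_size ->]; rewrite /= size_cat addn1. Qed.
Lemma rotate_size g h : rotate g h -> size h = size g.
Proof. by case=> a [k [/teq_size -> /teq_size ->]]; rewrite size_cat addn1. Qed.
Lemma slide_size g h : slide g h -> size h = size g.
Proof. by case=> _ _ [/teq_size ->|/rotate_size|/rotate_size]. Qed.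
Lemma slide_sym g h : slide g h -> slide h g.
Proof.
case=> rg rh H; split=> //; case: H => H; [constructor 1|constructor 3|constructor 2] => //.
exact: teq_sym.
Qed.
Lemma slide_teq g h : reduced g -> g =t h -> slide g h.
Proof. by move=> r h'; split => //; [apply: reduced_teq h' r|constructor 1]. Qed.

(** Distinct letters available at the same end commute, so removing the second leaves both letters
    of the shrinking by [a] in place. The removed letter cannot be the leading [phi a], since the
    two vertices are adjacent. *)
Lemma peak_right g g1 a b X : g =t phi a :: g1 ++ [:: linv a] -> b != a ->
  g =t X ++ [:: linv b] ->
  e a.1 b.1 /\ exists Z, g1 =t Z ++ [:: linv b] /\ X =t phi a :: Z ++ [:: linv a].
Proof.
move=> hg ba hX.
have := teq_trans (teq_sym hg) hX; rewrite -cat_cons => /levi_r[|].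
  by rewrite linv_inj eq_sym.
rewrite /= => eab [z [hz hX']]; split => //.
case: (levi_mixed hz) => [[Z [h1 h2]]|[_ ab _]].
  exists Z; split => //; apply: teq_trans hX' _.
  by rewrite -cat_cons; apply: teq_catr.
by move/(congr1 fst): ab eab; rewrite phi1 /= => ->; rewrite e_irr.
Qed.

Lemma peak_left g g1 a b X : g =t phi a :: g1 ++ [:: linv a] -> b != a ->
  g =t phi b :: X ->
  e a.1 b.1 /\ exists Z, g1 =t phi b :: Z /\ X =t phi a :: Z ++ [:: linv a].
Proof.
move=> hg ba hX.
have := teq_trans (teq_sym hg) hX => /levi[|].
  by rewrite (inj_eq (inv_inj phiK)) eq_sym.
rewrite !phi1 /= => eab [z [hz hX']]; split => //.
case: (levi_mixed (teq_sym hz)) => [[Z [h1 h2]]|[_ ab _]].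
  exists Z; split => //; apply: teq_trans hX' _.
  exact: teq_cons.
by move/(congr1 fst): ab eab; rewrite phi1 /= => ->; rewrite e_irr.
Qed.

Lemma shrink_teq g g' h h' : g =t g' -> h =t h' -> shrink g h -> shrink g' h'.
Proof.
move=> hg hh [r [a ha]]; split; first exact: reduced_teq hg r.
exists a; apply: teq_trans (teq_sym hg) _; apply: teq_trans ha _.
by apply/teq_cons/teq_catr.
Qed.

Lemma shrink_shrink g g1 g2 : shrink g g1 -> shrink g g2 ->
  exists h, (shrink g1 h \/ slide g1 h) /\ (shrink g2 h \/ slide g2 h).
Proof.
move=> s1 s2; have [r1 r2] := (shrink_reduced s1, shrink_reduced s2).
move: s1 s2 => [r [a ha]] [_ [b hb]].
case: (eqVneq b a) hb => [->|ba] hb.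
  have h12 : g1 =t g2.
    apply: (@teq_catr_inj [:: linv a]); apply: (@teq_cons_inj (phi a)).
    exact: teq_trans (teq_sym ha) hb.
  by exists g2; split; right; apply: slide_teq.
have [eab [Z [h1 hX]]] := @peak_right _ _ _ b (phi b :: g2) ha ba hb.
have [_ [Z' [h1' hX']]] := peak_left ha ba hb.
case: (levi_mixed (teq_trans (teq_sym h1') h1)) => [[z [hZ' hZ]]|[_ Eb cb]].
  exists z; split; left; split => //.
    exists b; apply: teq_trans h1 _.
    by rewrite -cat_cons; apply: teq_catr.
  exists a; apply: (@teq_catr_inj [:: linv b]).
  apply: teq_trans hX' _; rewrite cat_cons; apply: teq_cons; rewrite -catA.
  apply: teq_trans (teq_catr _ hZ') _; rewrite -catA; apply: teq_catl.
  by apply: teq_swap; rewrite /= e_sym.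
(* In the remaining case [phi b] and [linv b] would be one occurrence. But [phi b :: g2], which is
   [g] without its last [linv b], still contains [phi b], and none of the letters listed here can be
   it. *)
have : phi b \in phi a :: Z ++ [:: linv a].
  by rewrite -(perm_mem (teq_perm hX)) mem_head.
rewrite inE (negPf (phi_neq ba)) /= mem_cat => /orP[bZ|].
  by have := allP cb _ bZ; rewrite e_irr.
by rewrite mem_seq1 Eb linv_inj (negPf ba).
Qed.

Lemma teq_catsC a b Z : e a.1 b.1 -> (Z ++ [:: a]) ++ [:: b] =t (Z ++ [:: b]) ++ [:: a].
Proof. by move=> eab; rewrite -!catA; apply: teq_catl; apply: teq_swap. Qed.

(** A rotation moving one of the two letters of the shrinking would put it next to the other, and
    [g'] would not be reduced. So the rotated letter is a different one, commutes with the letter at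
    its end, and can be rotated after the shrinking. *)
Lemma shrink_slide g g1 g' : shrink g g1 -> slide g g' ->
  exists h, shrink g' h /\ (shrink g1 h \/ slide g1 h).
Proof.
move=> s1 [r r' H]; have r1 := shrink_reduced s1.
case: H => [hg|[c [k [hg hg']]]|[c [k [hg' hg]]]].
- by exists g1; split; [apply: shrink_teq s1|right; apply: slide_teq].
- case: s1 => _ [a ha]; have {}hg : g =t phi (phi c) :: k by rewrite phiK.
  case: (eqVneq (phi c) a) => [ca|ca].
    rewrite ca in hg; have hk := teq_cons_inj (teq_trans (teq_sym hg) ha).
    case: (r' g1 [::] (linv a)); apply: teq_trans hg' _; rewrite ca linvK.
    by apply: teq_trans (teq_catr _ hk) _; rewrite -catA.
  have [eab [Z [h1 hX]]] := peak_left ha ca hg.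
  have hs : g' =t phi a :: (Z ++ [:: phi c]) ++ [:: linv a].
    apply: teq_trans hg' _; apply: teq_trans (teq_catr _ hX) _; rewrite cat_cons.
    by apply: teq_cons; apply: teq_catsC.
  exists (Z ++ [:: phi c]); split; first by split => //; exists a.
  right; split => //; first exact: reduced_belast (reduced_behead (reduced_teq hs r')).
  by constructor 2; exists c, Z; rewrite phiK in h1.
- case: s1 => _ [a ha]; have {}hg : g =t k ++ [:: linv (linv (phi c))] by rewrite linvK.
  case: (eqVneq (linv (phi c)) a) => [ca|ca].
    rewrite ca in hg; rewrite -cat_cons in ha.
    have hk := teq_catr_inj (teq_trans (teq_sym hg) ha).
    case: (r' [::] g1 c); apply: teq_trans hg' _; apply: teq_cons.
    apply: teq_trans hk _; rewrite -ca phi_linv phiK //.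
  have [eab [Z [h1 hX]]] := peak_right ha ca hg; rewrite linvK in h1.
  have hs : g' =t phi a :: (c :: Z) ++ [:: linv a].
    apply: teq_trans hg' _; apply: teq_trans (teq_cons _ hX) _; apply: teq_swap2.
    by rewrite /= phi1 in eab; rewrite phi1 e_sym.
  exists (c :: Z); split; first by split => //; exists a.
  right; split => //; first exact: reduced_belast (reduced_behead (reduced_teq hs r')).
  by constructor 3; exists c, Z.
Qed.

(** Each of the two added letters cancels against [g] or does not. If both do, this is a shrinking;
    if neither does, a converse shrinking; if one does, a rotation. Should they cancel each other,
    the trace is unchanged. *)
Lemma conj_letter g g' b : reduced g -> reduced g' ->
  raag_eq e g' (linv (phi b) :: g ++ [:: b]) ->
  [\/ shrink g g', shrink g' g | slide g g'].
Proof.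
move=> r r' hg'.
case: (Classical_Prop.classic (exists h, g =t h ++ [:: linv b])) => [[h hg]|nb].
  have {}hg' : raag_eq e g' (linv (phi b) :: h).
    apply: raag_trans hg' _; apply: raag_cons.
    apply: raag_trans (raag_catr _ (teq_raag hg)) _; rewrite -catA.
    by apply: raag_trans (raag_catl _ (raag_cancelV _ _)) _; rewrite cats0; apply: raag_refl.
  have rh := reduced_belast (reduced_teq hg r).
  case: (Classical_Prop.classic (exists k, h =t phi b :: k)) => [[k hk]|nk].
    constructor 1; split => //; exists b; apply: teq_trans hg _.
    apply: teq_trans (teq_catr _ hk) _; rewrite cat_cons; apply: teq_cons; apply: teq_catr.
    apply: teq_sym; apply: raag_teq => //; first exact: reduced_behead (reduced_teq hk rh).
    apply: raag_trans hg' _; apply: raag_trans (raag_cons _ (teq_raag hk)) _.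
    exact: raag_cancelV.
  have hgg : g' =t linv (phi b) :: h.
    by apply: raag_teq => //; apply: reduced_cons => //; rewrite linvK.
  constructor 3; split => //; constructor 3; exists (linv (phi b)), h.
  by rewrite phi_linv phiK.
have rgb := reduced_rcons r nb.
case: (Classical_Prop.classic (exists k, g ++ [:: b] =t phi b :: k)) => [[k hk]|nk].
  have hgk : g' =t k.
    apply: raag_teq => //; first exact: reduced_behead (reduced_teq hk rgb).
    apply: raag_trans hg' _; apply: raag_trans (raag_cons _ (teq_raag hk)) _.
    exact: raag_cancelV.
  constructor 3; split => //.
  case: (levi_mixed (teq_sym hk)) => [[z [h1 h2]]|[h1 _ _]].
    by constructor 2; exists (phi b), z; rewrite phiK; split => //; apply: teq_trans h1.
  by constructor 1; apply: teq_sym; apply: teq_trans h1.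
constructor 2; split => //; exists (linv b); rewrite linvK phi_linv.
by apply: raag_teq => //; apply: reduced_cons => //; rewrite linvK.
Qed.

(** * The trace equation between fully shrunk forms *)

Definition forward (p q : seq (letter n)) := exists t, p ++ map phi t =t t ++ q.
(** Confluence is stated modulo an equivalence, so symmetry is built in. *)
Definition plateau (p q : seq (letter n)) := forward p q /\ forward q p.

Lemma forward_trans (p q r : seq (letter n)) : forward p q -> forward q r -> forward p r.
Proof.
move=> [t ht] [s hs]; exists (t ++ s); rewrite map_cat catA.
by apply: teq_trans (teq_catr _ ht) _; rewrite -!catA; apply: teq_catl.
Qed.

Lemma forward_teq (p q : seq (letter n)) : p =t q -> forward p q.
Proof. by move=> h; exists [::]; rewrite cats0. Qed.

Lemma rotate_forward g h : rotate g h -> forward g h /\ forward h g.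
Proof.
move=> [a [k [hg hh]]]; split.
  exists [:: a]; apply: teq_trans (teq_catr _ hg) _; rewrite cat_cons /=.
  by apply/teq_cons/teq_sym.
(* Undoing the rotation of one letter means rotating the rest of two full periods, because [phi] is
   an involution. *)
exists (k ++ phi a :: map phi k); rewrite map_cat /= phiK -map_comp.
rewrite [X in a :: X](_ : _ = k); last by rewrite -[RHS]map_id; apply: eq_map => c; apply: phiK.
apply: teq_trans (teq_catr _ hh) _; rewrite -!catA /=; apply: teq_catl; apply: teq_cons.
exact: teq_catl (teq_sym hg).
Qed.

Lemma slide_plateau g h : slide g h -> plateau g h.
Proof.
case=> _ _ [h'|/rotate_forward //|/rotate_forward[]//].
by split; apply: forward_teq => //; apply: teq_sym.
Qed.

Lemma inv_word_cons a w : inv_word (phi_word xs (a :: w)) =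
  inv_word (phi_word xs w) ++ [:: linv (phi a)].
Proof. by rewrite /inv_word /phi_word /= rev_cons cats1. Qed.

(** The conjugator is applied one letter at a time; passing to [nf] in between keeps the traces
    reduced, as [conj_letter] requires. *)
Lemma twisted_conj_steps u v (p q : seq (letter n)) : twisted_conj e xs u v ->
  reduced p -> raag_eq e p u -> reduced q -> raag_eq e q v ->
  clos_refl_sym_trans _ (fun x y => shrink x y \/ slide x y) p q.
Proof.
move=> [w hv] rp hp rq hq; have {hv}hq := raag_trans hq hv.
elim: w u p rp hp hq => [|a w IH] u p rp hp hq.
  apply: rst_step; right; apply: slide_teq => //; apply: raag_teq => //.
  rewrite /= cats0 in hq; exact: raag_trans hp (raag_sym hq).
set u1 := linv (phi a) :: u ++ [:: a].
apply: (rst_trans _ _ _ (nf u1)); last first.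
  apply: (IH u1); [exact: nf_reduced|exact: nf_raag|].
  by move: hq; rewrite inv_word_cons -!catA /= -!catA.
have [|||s|s|s] := @conj_letter p (nf u1) a.
- by [].
- exact: nf_reduced.
- apply: raag_trans (nf_raag _) _; apply: raag_cons; apply: raag_catr; exact: raag_sym.
- by apply: rst_step; left.
- by apply: rst_sym; apply: rst_step; left.
- by apply: rst_step; right.
Qed.

Lemma twisted_conj_plateau u v (p q : seq (letter n)) : twisted_conj e xs u v ->
  normalizes shrink (nf u) p -> normalizes shrink (nf v) q -> forward p q.
Proof.
move=> huv np nq.
have [] // : plateau p q.
apply: (church_rosser_modulo (sz := size) (S := slide) _ _ _ _ _ _ _ _ _ _ np nq).
- exact: shrink_size.
- exact: slide_size.
- exact: slide_sym.
- exact: shrink_shrink.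
- exact: shrink_slide.
- by move=> g; split; apply: forward_teq.
- by move=> g h [].
- by move=> g h k [h1 h2] [h3 h4]; split; [apply: forward_trans h3|apply: forward_trans h2].
- exact: slide_plateau.
- by apply: (twisted_conj_steps huv);
    [apply: nf_reduced|apply: nf_raag|apply: nf_reduced|apply: nf_raag].
Qed.

(** * Soundness: shrinking and rotating are twisted conjugations *)

Lemma inv_word_cat (s t : seq (letter n)) : inv_word (s ++ t) = inv_word t ++ inv_word s.
Proof. by rewrite /inv_word map_cat rev_cat. Qed.

Lemma inv_wordK w : raag_eq e (inv_word w ++ w) [::].
Proof.
elim: w => [|a w IH]; first exact: raag_refl.
rewrite /inv_word /= rev_cons -cats1 -catA /=.
by apply: raag_trans (raag_catl _ (raag_cancelV _ _)) _.
Qed.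

Lemma inv_word_inv w : inv_word (inv_word w) = w.
Proof. by rewrite /inv_word map_rev revK -map_comp -[RHS]map_id; apply: eq_map => a; apply: linvK. Qed.

Lemma inv_word_phi w : phi_word xs (inv_word w) = inv_word (phi_word xs w).
Proof.
rewrite /phi_word /inv_word map_rev -!map_comp; congr rev.
by apply: eq_map => a /=; apply: phi_linv.
Qed.

Lemma twisted_conj_raag u v : raag_eq e u v -> twisted_conj e xs u v.
Proof. by exists [::]; rewrite /= cats0; apply: raag_sym. Qed.

Lemma twisted_conj_trans v u w : twisted_conj e xs u v -> twisted_conj e xs v w ->
  twisted_conj e xs u w.
Proof.
move=> [s hs] [t ht]; exists (s ++ t); apply: raag_trans ht _.
rewrite /phi_word map_cat inv_word_cat -!catA; apply: raag_catl.
by apply: raag_trans (raag_catr _ hs) _; rewrite -!catA; apply: raag_refl.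
Qed.

Lemma twisted_conj_sym u v : twisted_conj e xs u v -> twisted_conj e xs v u.
Proof.
move=> [s hs]; exists (inv_word s); apply: raag_sym.
apply: raag_trans (raag_catl _ (raag_catr _ hs)) _.
rewrite inv_word_phi inv_word_inv -!catA.
have K w : raag_eq e (w ++ inv_word w) [::].
  by have := inv_wordK (inv_word w); rewrite inv_word_inv.
rewrite catA -[X in raag_eq e _ X]cats0.
apply: raag_trans (raag_catr _ (K _)) _; rewrite /=.
by apply: raag_catl.
Qed.

Lemma twisted_conj_letter a g h : raag_eq e (phi a :: h ++ [:: linv a]) g ->
  twisted_conj e xs g h.
Proof.
move=> H; exists [:: a]; rewrite /inv_word /=.
apply: raag_trans (raag_cons _ (raag_catr _ H)).
apply: raag_sym; rewrite cat_cons; apply: raag_trans (raag_cancelV _ _) _.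
rewrite -catA; apply: raag_trans (raag_catl _ (raag_cancelV _ _)) _.
rewrite cats0; exact: raag_refl.
Qed.

Lemma shrink_twisted_conj g h : shrink g h -> twisted_conj e xs g h.
Proof.
by move=> [_ [a /teq_raag hg]]; apply: (@twisted_conj_letter a); apply: raag_sym.
Qed.

Lemma rotate_twisted_conj g h : rotate g h -> twisted_conj e xs g h.
Proof.
move=> [a [k [hg hh]]]; apply: (@twisted_conj_letter (phi a)); rewrite phiK.
apply: raag_trans (raag_sym (teq_raag hg)); apply: raag_cons.
apply: raag_trans (raag_catr _ (teq_raag hh)) _; rewrite -catA.
by apply: raag_trans (raag_catl _ (raag_cancel _ _)) _; rewrite cats0; apply: raag_refl.
Qed.

Lemma shrinks_twisted_conj g h : clos_refl_trans_1n _ shrink g h -> twisted_conj e xs g h.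
Proof.
elim=> [x|x y z /shrink_twisted_conj h1 _ h2]; last exact: twisted_conj_trans h2.
exact/twisted_conj_raag/raag_refl.
Qed.

(** * Bounding the number of rotations *)

Definition cnt (y : 'I_n) w := count (fun a => a.1 == y) w.

Lemma cnt_cat (y : 'I_n) u v : cnt y (u ++ v) = cnt y u + cnt y v. Proof. exact: count_cat. Qed.
Lemma cnt_phi (y : 'I_n) w : cnt y (map phi w) = cnt y w.
Proof. by rewrite /cnt count_map; apply: eq_count => a; rewrite /= phi1. Qed.
Lemma cnt_teq (y : 'I_n) u v : u =t v -> cnt y u = cnt y v.
Proof. by move/teq_perm/permP; apply. Qed.
Lemma cnt_pr (y : 'I_n) p w : (y == p.1) || (y == p.2) -> cnt y (pr p w) = cnt y w.
Proof.
move=> yp; rewrite /cnt count_filter; apply: eq_count => a /=.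
by case: eqP => // ay; rewrite /meets ay yp.
Qed.
Lemma size_cnt w : size w = \sum_(y < n) cnt y w.
Proof.
elim: w => [|a w IH]; first by rewrite big1.
rewrite /= IH big_split /= -add1n; congr (_ + _).
by rewrite (bigD1 a.1) //= eqxx big1 // => y /negPf; rewrite eq_sym => ->.
Qed.

(** [G] and [T] are prefixes of the same word, and the count of [y] rules out that [T] is the
    shorter. Cancelling [G] leaves the same equation with [map phi G] as the period. *)
Lemma peel (y : 'I_n) (G T Q : seq (letter n)) : G ++ map phi T = T ++ Q -> cnt y G < cnt y T ->
  exists T1, T = G ++ T1 /\ map phi G ++ map phi T1 = T1 ++ Q.
Proof.
move=> h lt; case: (leqP (size G) (size T)) => sz.
  have GT : G = take (size G) T.
    by have := congr1 (take (size G)) h; rewrite take_size_cat // takel_cat.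
  have ET : T = G ++ drop (size G) T by rewrite [X in X ++ _]GT cat_take_drop.
  exists (drop (size G) T); split => //; rewrite -map_cat -ET.
  by move: h; rewrite [in RHS]ET -catA => /eqP; rewrite eqseq_cat // eqxx => /eqP.
have TG : T = take (size T) G.
  by have := congr1 (take (size T)) h; rewrite [in RHS]take_size_cat // takel_cat // ltnW.
have : cnt y T <= cnt y G by rewrite -[G in leqRHS](cat_take_drop (size T)) -TG cnt_cat leq_addr.
by rewrite leqNgt lt.
Qed.

(** Each period peeled off carries all letters of [G], those at [z] included. The last period of [y]
    is lost because [peel] needs a strict inequality. *)
Lemma cnt_spread k (y z : 'I_n) (G T Q : seq (letter n)) : G ++ map phi T = T ++ Q ->
  0 < cnt y G -> k.+1 * cnt y G <= cnt y T -> k * cnt z G <= cnt z T.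
Proof.
elim: k G T => // k IH G T h G0 le.
have [|T1 [ET h1]] := peel (y := y) h; first by lia.
have := IH _ _ h1; rewrite !cnt_phi => /(_ G0).
move: le; rewrite ET !cnt_cat; lia.
Qed.

(** Two peelings bring back the period [G], as [phi] is an involution. The factor 3 leaves the
    strict inequality that the second one needs. *)
Lemma peel2 (y : 'I_n) (G T Q : seq (letter n)) : G ++ map phi T = T ++ Q ->
  0 < cnt y G -> 3 * cnt y G <= cnt y T ->
  exists T2, T = G ++ map phi G ++ T2 /\ G ++ map phi T2 = T2 ++ Q.
Proof.
move=> h G0 le; have [|T1 [ET h1]] := peel (y := y) h; first by lia.
have [|T2 [ET1 h2]] := peel (y := y) h1.
  by move: le; rewrite cnt_phi ET cnt_cat; lia.
exists T2; rewrite ET ET1; split => //.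
by rewrite -h2 -map_comp; congr (_ ++ _); rewrite -[LHS]map_id; apply: eq_map => a /=; rewrite phiK.
Qed.

Lemma filter_pr (P : pred (letter n)) p w : pr p (filter P w) = filter P (pr p w).
Proof. by rewrite /pr -!filter_predI; apply: eq_filter => a /=; rewrite andbC. Qed.
Lemma teq_filter (P : pred (letter n)) u v : u =t v -> filter P u =t filter P v.
Proof. by move=> h p np; rewrite !filter_pr h. Qed.

Lemma cnt0_filter (y : 'I_n) w : cnt y w = 0 -> filter (fun a => a.1 != y) w = w.
Proof.
move=> h; apply/all_filterP/allP => a aw; apply: contraT; rewrite negbK => ay.
have : 0 < cnt y w by rewrite -has_count; apply/hasP; exists a.
by rewrite h.
Qed.

(** A descending chain of sets of vertices cannot be strict [n.+1] times in a row. *)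
Lemma stable_level (L : nat -> {set 'I_n}) k (x : 'I_n) : (forall j, L j.+1 \subset L j) ->
  x \in L (k + n.+1) -> exists2 j, k <= j < k + n.+1 & L j = L j.+1.
Proof.
move=> Ld xL.
have [/existsP[[j jn] /= /eqP E]|] := boolP [exists j : 'I_n.+1, L (k + j) == L (k + j).+1].
  by exists (k + j) => //; lia.
rewrite negb_exists => /forallP ne.
have H j : j <= n.+1 -> #|L (k + j)| + j <= n.
  elim: j => [_|j IH lt]; first by rewrite addn0 -[n in _ <= n]card_ord max_card.
  have : L (k + j).+1 \proper L (k + j).
    rewrite properEneq Ld andbT eq_sym; exact: (ne (Ordinal lt)).
  by move/proper_card; have := IH (ltnW lt); rewrite [k + j.+1]addnS; lia.
by have := H n.+1 (leqnn _); lia.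
Qed.

(* If some vertex is used far too often by [t], then so is a set [C] of vertices that
   is closed under noncommutation within the support of [g], and two periods
   [g ++ phi g] can be erased from the [C]-part of [t]. *)
Lemma forward_shorten g q t (x : 'I_n) : g ++ map phi t =t t ++ q ->
  (n + 4) * cnt x g < cnt x t -> exists2 t', g ++ map phi t' =t t' ++ q & size t' < size t.
Proof.
move=> h big.
have cq (y : 'I_n) : cnt y q = cnt y g by have := cnt_teq y h; rewrite !cnt_cat cnt_phi; lia.
(* A vertex missing from [g] is missing from [q] as well, and can simply be deleted from [t]. *)
have erase (y : 'I_n) : cnt y g = 0 -> 0 < cnt y t ->
    exists2 t', g ++ map phi t' =t t' ++ q & size t' < size t.
  move=> g0 t0; exists (filter (fun a => a.1 != y) t).
    have := teq_filter (fun a => a.1 != y) h; rewrite !filter_cat filter_map.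
    rewrite (cnt0_filter g0) (cnt0_filter (etrans (cq y) g0)).
    rewrite (eq_filter (a2 := fun a : letter n => a.1 != y)) // => a /=.
    by rewrite phi1.
  by rewrite size_filter -(count_predC (fun a => a.1 == y) t) -add1n leq_add2r.
have [/existsP[y /andP[/eqP g0 t0]]|] := boolP [exists y, (cnt y g == 0) && (0 < cnt y t)].
  exact: erase g0 t0.
rewrite negb_exists => /forallP supp {erase}.
have {}supp y : cnt y g = 0 -> cnt y t = 0.
  by move=> g0; have := supp y; rewrite g0 eqxx /= lt0n negbK => /eqP.
(* Vertices that [t] uses for at least [k] periods. The levels start at 3, as [peel2] requires, and
   among the next [n.+1] one is stationary; this is the origin of [n + 4]. *)
pose L k := [set y | (0 < cnt y g) && (k * cnt y g <= cnt y t)].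
have x0 : 0 < cnt x g by case: (posnP (cnt x g)) big => // g0; rewrite (supp _ g0).
have [||k /andP[k3 kn] Lk] := @stable_level L 3 x.
- move=> k; apply/subsetP => y; rewrite !inE => /andP[-> /=]; apply: leq_trans.
  by rewrite mulSn leq_addl.
- rewrite inE x0 /=; apply: leq_trans (ltnW big); rewrite leq_mul2r; lia.
have xC : x \in L k.
  rewrite inE x0 /=; apply: leq_trans (ltnW big); rewrite leq_mul2r; lia.
pose inC := [pred a : letter n | a.1 \in L k].
have C0 y : y \in L k -> 0 < cnt y g by rewrite inE => /andP[].
have C3 y : y \in L k -> 3 * cnt y g <= cnt y t.
  by rewrite inE => /andP[_]; apply: leq_trans; rewrite leq_mul2r k3 orbT.
have prh p : ~~ e p.1 p.2 -> pr p g ++ map phi (pr p t) = pr p t ++ pr p q.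
  by move=> np; rewrite -pr_phi -!pr_cat h.
(* Spreading loses one period, but [y] also lies in [L k.+1]. *)
have closed y z : y \in L k -> ~~ e y z -> 0 < cnt z g -> z \in L k.
  rewrite {1}Lk !inE => /andP[y0 yk] nyz z0; rewrite z0 /=.
  have := @cnt_spread k y z _ _ _ (prh (y, z) nyz).
  by rewrite !cnt_pr /= ?eqxx ?orbT //; apply.
pose meetsC p := (p.1 \in L k) || (p.2 \in L k).
have inCE p a : ~~ e p.1 p.2 -> meets a p -> 0 < cnt a.1 g -> inC a = meetsC p.
  move=> np; rewrite /meets /inC /meetsC /= => /orP[]/eqP-> a0.
    have [//|p1] /= := boolP (p.1 \in L k).
    by apply/esym; apply: contraNF p1 => p2; apply: closed p2 _ a0; rewrite e_sym.
  have [_|p2] /= := boolP (p.2 \in L k); first by rewrite orbT.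
  by rewrite orbF; apply/esym; apply: contraNF p2 => p1; apply: closed p1 np a0.
have mem_cnt a w : a \in w -> 0 < cnt a.1 w.
  by move=> aw; rewrite -has_count; apply/hasP; exists a.
have inP p w : ~~ e p.1 p.2 -> (forall a, a \in w -> 0 < cnt a.1 g) ->
    filter inC (pr p w) = if meetsC p then pr p w else [::].
  move=> np hw; rewrite /pr -filter_predI -(filter_pred0 w).
  case: ifP => Cp; apply: eq_in_filter => a aw /=; rewrite andbC;
    case: (boolP (meets a p)) => //= ap; have := inCE p a np ap (hw a aw);
    by rewrite Cp /= => ->.
have outP p w : ~~ e p.1 p.2 -> (forall a, a \in w -> 0 < cnt a.1 g) ->
    filter (predC inC) (pr p w) = if meetsC p then [::] else pr p w.
  move=> np hw; rewrite /pr -filter_predI -(filter_pred0 w).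
  case: ifP => Cp; apply: eq_in_filter => a aw /=; rewrite andbC;
    case: (boolP (meets a p)) => //= ap; have := inCE p a np ap (hw a aw);
    by rewrite Cp /= => ->.
have tg a : a \in t -> 0 < cnt a.1 g.
  by move/mem_cnt; rewrite !lt0n; apply: contra => /eqP/supp->.
have gg a : a \in g ++ map phi g -> 0 < cnt a.1 g.
  by move/mem_cnt; rewrite cnt_cat cnt_phi addn_gt0 orbb.
have [|t2 ht2] := @pr_pairs_teq (filter inC (g ++ map phi g)) (filter inC t).
  move=> p np; rewrite !filter_pr !inP //; case: ifP => [Cp|_]; last by exists [::].
  have [y yp yC] : exists2 y, (y == p.1) || (y == p.2) & y \in L k.
    by case/orP: Cp => Cp; [exists p.1|exists p.2]; rewrite ?eqxx ?orbT.
  have [||T2 [ET _]] := peel2 (y := y) (prh p np); rewrite ?cnt_pr ?C0 ?C3 //.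
  by exists T2; rewrite pr_cat pr_phi -catA.
(* Letters outside [L k] may be put last, since within the support of [g] they commute with those
   inside. *)
exists (t2 ++ filter (predC inC) t); last first.
  have := teq_size ht2; rewrite size_cat !size_filter => E.
  have : 0 < count inC (g ++ map phi g).
    rewrite -has_count; have /hasP[a ag /eqP ax] : has (fun a => a.1 == x) g by rewrite has_count.
    by apply/hasP; exists a; rewrite ?mem_cat ?ag // /inC /= ax.
  by rewrite -(count_predC inC t) size_cat size_filter E; lia.
move=> p np; have := ht2 p np; rewrite !pr_cat pr_phi !pr_cat !filter_pr !inP // !outP //.
case: ifP => [Cp|_ /= <-]; last exact: prh.
rewrite !cats0 => ET.
have [y yp yC] : exists2 y, (y == p.1) || (y == p.2) & y \in L k.
  by case/orP: Cp => Cp; [exists p.1|exists p.2]; rewrite ?eqxx ?orbT.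
have [||T2 [ET2 hT2]] := peel2 (y := y) (prh p np); rewrite ?cnt_pr ?C0 ?C3 //.
move: ET; rewrite pr_cat pr_phi ET2 -catA => /eqP; rewrite !eqseq_cat // !eqxx /=.
by move/eqP => <-.
Qed.

Lemma forward_bounded g q : forward g q ->
  exists2 t, g ++ map phi t =t t ++ q & forall x, cnt x t <= (n + 4) * cnt x g.
Proof.
move=> [t]; have [k] := ubnP (size t); elim: k t => // k IH t lt h.
have [/forallP small|] := boolP [forall x, cnt x t <= (n + 4) * cnt x g]; first by exists t.
rewrite negb_forall => /existsP[x]; rewrite -ltnNge => big.
have [t' h' lt'] := forward_shorten h big.
by apply: (IH t') => //; apply: leq_trans lt' _.
Qed.

(** * The program *)

Definition seqs (T : Type) (f : T -> cmd) l := foldr (fun x => Seq (f x)) Skip l.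

Lemma loopfree_seqs (T : Type) (f : T -> cmd) l :
  (forall x, loopfree (f x)) -> loopfree (seqs f l).
Proof. by move=> h; elim: l => //= x l ->; rewrite h. Qed.

Lemma writes_seqs (T : Type) (f : T -> cmd) (Q : pred reg) l :
  (forall x, all Q (writes (f x))) -> all Q (writes (seqs f l)).
Proof. by move=> h; elim: l => //= x l IH; rewrite all_cat h. Qed.

Lemma den_only (c : cmd) (Q : pred reg) s r : all Q (writes c) -> ~~ Q r -> den c s r = s r.
Proof. by move=> /allP h nr; apply: den_frame; apply: contra nr; apply: h. Qed.

Lemma set_reg_neq s r r' (v : nat) : r' != r -> set_reg s r v r' = s r'.
Proof. by rewrite /set_reg => /negPf ->. Qed.
Lemma set_reg_eq s r (v : nat) : set_reg s r v r = v.
Proof. by rewrite /set_reg eqxx. Qed.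

Definition neqx x y := Bin Add (Bin Sub x y) (Bin Sub y x).
Definition eqx x y := Bin Sub (Const 1) (neqx x y).
Definition allx l := foldr (Bin Mul) (Const 1) l.

Lemma neqxE x y s : (eval (neqx x y) s != 0) = (eval x s != eval y s).
Proof. by rewrite /=; lia. Qed.
Lemma eqxE x y s : (eval (eqx x y) s != 0) = (eval x s == eval y s).
Proof. by rewrite /=; lia. Qed.
Lemma allxE l s : (eval (allx l) s != 0) = all (fun x => eval x s != 0) l.
Proof. by elim: l => //= x l <-; rewrite muln_eq0 negb_or. Qed.
Lemma mulxE x y s : (eval (Bin Mul x y) s != 0) = (eval x s != 0) && (eval y s != 0).
Proof. by rewrite /= muln_eq0 negb_or. Qed.

(* [rM f p] holds the projection to [p] of the word number [f] (true for the word
   derived from u, false for v), as a number whose least significant digit is the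
   first letter; [rP f p] holds [radix] to the length of the projection.  The
   register [rF x] flags a vertex that has to be rotated. *)
Definition rM (f : bool) p : reg := [:: 3; nat_of_bool f; nat_of_ord p.1; nat_of_ord p.2].
Definition rP (f : bool) p : reg := [:: 4; nat_of_bool f; nat_of_ord p.1; nat_of_ord p.2].
Definition rF (x : 'I_n) : reg := [:: 5; nat_of_ord x].
Definition rC : reg := [:: 6].
Definition rD : reg := [:: 7].

Definition in_fam (f : bool) (r : reg) :=
  if r is [:: k; b; _; _] then ((k == 3) || (k == 4)) && (b == f) else false.

Lemma rM_eq f p q : (rM f p == rM f q) = (p == q).
Proof. by case: p q => [x y] [z w]; rewrite /rM !eqseq_cons !eqxx /= andbT xpair_eqE. Qed.
Lemma rP_eq f p q : (rP f p == rP f q) = (p == q).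
Proof. by case: p q => [x y] [z w]; rewrite /rP !eqseq_cons !eqxx /= andbT xpair_eqE. Qed.
Lemma rF_eq x y : (rF x == rF y) = (x == y).
Proof. by rewrite /rF !eqseq_cons !eqxx /= andbT. Qed.

(** The order matters: the new value of [rM] may depend on the old [rP]. *)
Definition update f l (xM xP : 'I_n * 'I_n -> expr) :=
  seqs (fun p => Seq (Asg (rM f p) (xM p)) (Asg (rP f p) (xP p))) l.

Lemma update_den f l xM xP (FM : nat -> nat -> nat) (FP : nat -> nat) s :
  uniq l -> (forall p t, eval (xM p) t = FM (t (rM f p)) (t (rP f p))) ->
  (forall p t, eval (xP p) t = FP (t (rP f p))) ->
  forall p, den (update f l xM xP) s (rM f p) =
              (if p \in l then FM (s (rM f p)) (s (rP f p)) else s (rM f p)) /\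
            den (update f l xM xP) s (rP f p) =
              (if p \in l then FP (s (rP f p)) else s (rP f p)).
Proof.
move=> ul hM hP p; elim: l s ul => [|q l IH] s //= /andP[nq ul].
set t := set_reg _ _ _; have [-> ->] := IH t ul; rewrite inE.
have tM : t (rM f p) = if p == q then FM (s (rM f p)) (s (rP f p)) else s (rM f p).
  by rewrite /t set_reg_neq // /set_reg rM_eq hM; case: eqP => // ->.
have tP : t (rP f p) = if p == q then FP (s (rP f p)) else s (rP f p).
  by rewrite /t {1}/set_reg rP_eq hP set_reg_neq //; case: eqP => [->|_] //; rewrite set_reg_neq.
rewrite tM tP; case: eqP nq => [->|_] nq //=.
by rewrite (negPf nq).
Qed.

Lemma update_writes f l xM xP : all (in_fam f) (writes (update f l xM xP)).
Proof. by apply: writes_seqs => p; rewrite /= !eqxx. Qed.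

Local Notation radix := (radix n).

(** * Projections as numbers in base [radix] *)

Definition enc w := foldr (fun a m => code a + radix * m) 0 w.

Definition hd_code w := if w is a :: _ then code a else 0.

Lemma enc_mod w : enc w %% radix = hd_code w.
Proof.
by case: w => [|a w]; rewrite /= ?mod0n // addnC mulnC modnMDl modn_small // code_lt.
Qed.
Lemma enc_div w : enc w %/ radix = enc (behead w).
Proof.
by case: w => [|a w]; rewrite /= ?div0n // addnC mulnC divnMDl // divn_small ?addn0 // code_lt.
Qed.
Lemma hd_codeE a w : (hd_code w == code a) = (ohead w == Some a).
Proof.
case: w => [|b w] //=; apply/eqP/eqP => [/code_inj -> //|[->] //].
Qed.
Lemma enc_eq0 w : (enc w == 0) = (w == [::]).
Proof. by case: w => // a w /=; apply/eqP; rewrite /code; lia. Qed.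
(** Codes are positive, so the encoding needs no separate length to be faithful. *)
Lemma enc_inj : injective enc.
Proof.
move=> u; elim: u => [|a u IH] v E; first by apply/eqP; rewrite eq_sym -enc_eq0 -E.
case: v E => [|b v] E; first by move: (enc_eq0 (a :: u)); rewrite E.
have := enc_mod (a :: u); rewrite E enc_mod /= => /code_inj ->.
by have := enc_div (a :: u); rewrite E enc_div /= => /esym /IH ->.
Qed.
Lemma enc_lt w : enc w < radix ^ size w.
Proof.
elim: w => //= a w IH; rewrite expnS.
apply: (@leq_trans (radix * (enc w).+1)); last by rewrite leq_mul2l IH orbT.
by rewrite mulnS ltn_add2r code_lt.
Qed.
Lemma enc_rcons w a : enc (w ++ [:: a]) = enc w + code a * radix ^ size w.
Proof.
elim: w => [|b w IH] /=; first by rewrite !muln0 muln1 addn0.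
by rewrite IH expnS mulnDr addnA mulnCA.
Qed.
Lemma radix_expn k : 0 < radix ^ k. Proof. by rewrite expn_gt0. Qed.

Lemma enc_last_div w : enc w %/ (radix ^ size w %/ radix) = hd_code (rev w).
Proof.
case/lastP: w => [|w a]; first by rewrite /= div0n.
rewrite rev_rcons size_rcons expnS mulKn // -cats1 enc_rcons addnC.
by rewrite divnMDl ?radix_expn // divn_small ?enc_lt // addn0.
Qed.
Lemma enc_last_mod w a : enc (w ++ [:: a]) %% (radix ^ size (w ++ [:: a]) %/ radix) = enc w.
Proof. by rewrite size_cat addn1 expnS mulKn // enc_rcons addnC modnMDl modn_small // enc_lt. Qed.

(** Only projections are stored, so [w] can be replaced by any word of the same trace, in particular
    by one that shows a given letter at its end. *)
Definition Fam f w (s : state) := forall p, ~~ e p.1 p.2 ->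
  s (rM f p) = enc (pr p w) /\ s (rP f p) = radix ^ size (pr p w).

Lemma Fam_ext f w s t : (forall r, in_fam f r -> t r = s r) -> Fam f w s -> Fam f w t.
Proof. by move=> h hs p np; rewrite !h ?/in_fam /= ?eqxx //; apply: hs. Qed.

Lemma Fam_frame f w (c : cmd) s : all (predC (in_fam f)) (writes c) -> Fam f w s -> Fam f w (den c s).
Proof. by move=> h; apply: Fam_ext => r fr; apply: den_only h _; rewrite /= negbK. Qed.

Lemma Fam_set f w s r (x : nat) : ~~ in_fam f r -> Fam f w s -> Fam f w (set_reg s r x).
Proof.
move=> nr; apply: Fam_ext => r' fr; rewrite set_reg_neq //.
by apply: contraNneq nr => <-.
Qed.

Lemma uniq_pairs a : uniq (pairs a). Proof. by rewrite filter_uniq ?enum_uniq. Qed.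

Lemma Fam_update f a xM xP (FM : nat -> nat -> nat) (FP : nat -> nat) s w w' :
  (forall p t, eval (xM p) t = FM (t (rM f p)) (t (rP f p))) ->
  (forall p t, eval (xP p) t = FP (t (rP f p))) ->
  (forall p, ~~ e p.1 p.2 -> if meets a p then
     FM (enc (pr p w)) (radix ^ size (pr p w)) = enc (pr p w') /\
     FP (radix ^ size (pr p w)) = radix ^ size (pr p w') else pr p w = pr p w') ->
  Fam f w s -> Fam f w' (den (update f (pairs a) xM xP) s).
Proof.
move=> hM hP h fs p np; have [-> ->] := update_den s (uniq_pairs a) hM hP p.
have [-> ->] := fs p np; rewrite mem_pairs np /=.
by have := h p np; case: ifP => _ // ->.
Qed.

Definition pop_left f a := update f (pairs a)
  (fun p => Bin Div (Reg (rM f p)) (Const radix)) (fun p => Bin Div (Reg (rP f p)) (Const radix)).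
Definition push_left f a := update f (pairs a)
  (fun p => Bin Add (Bin Mul (Reg (rM f p)) (Const radix)) (Const (code a)))
  (fun p => Bin Mul (Reg (rP f p)) (Const radix)).
Definition pop_right f a := update f (pairs a)
  (fun p => Bin Mod (Reg (rM f p)) (Bin Div (Reg (rP f p)) (Const radix)))
  (fun p => Bin Div (Reg (rP f p)) (Const radix)).
Definition push_right f a := update f (pairs a)
  (fun p => Bin Add (Reg (rM f p)) (Bin Mul (Const (code a)) (Reg (rP f p))))
  (fun p => Bin Mul (Reg (rP f p)) (Const radix)).

Lemma Fam_pop_left f a w h s : w =t a :: h -> Fam f w s -> Fam f h (den (pop_left f a) s).
Proof.
move=> hw; apply: (Fam_update (FM := fun m _ => m %/ radix) (FP := fun q => q %/ radix)) => //.
move=> p np; rewrite hw // pr_cons; case: (meets a p) => //.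
by rewrite enc_div /= expnS mulKn.
Qed.
Lemma Fam_push_left f a w s : Fam f w s -> Fam f (a :: w) (den (push_left f a) s).
Proof.
apply: (Fam_update (FM := fun m _ => m * radix + code a) (FP := fun q => q * radix)) => //.
move=> p np; rewrite pr_cons; case: (meets a p) => //.
by rewrite /= expnSr addnC mulnC.
Qed.
Lemma Fam_pop_right f a w h s : w =t h ++ [:: a] -> Fam f w s -> Fam f h (den (pop_right f a) s).
Proof.
move=> hw; apply: (Fam_update (FM := fun m q => m %% (q %/ radix)) (FP := fun q => q %/ radix)) => //.
move=> p np; rewrite hw // pr_cat pr_cons; case: (meets a p); last by rewrite cats0.
by rewrite enc_last_mod size_cat addn1 expnS mulKn.
Qed.
Lemma Fam_push_right f a w s : Fam f w s -> Fam f (w ++ [:: a]) (den (push_right f a) s).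
Proof.
apply: (Fam_update (FM := fun m q => m + code a * q) (FP := fun q => q * radix)) => //.
move=> p np; rewrite pr_cat pr_cons; case: (meets a p); last by rewrite cats0.
by rewrite enc_rcons size_cat addn1 expnSr.
Qed.

Definition headx f p := Bin Mod (Reg (rM f p)) (Const radix).
Definition lastx f p := Bin Div (Reg (rM f p)) (Bin Div (Reg (rP f p)) (Const radix)).
Definition left_test f a := allx [seq eqx (headx f p) (Const (code a)) | p <- pairs a].
Definition right_test f a := allx [seq eqx (lastx f p) (Const (code a)) | p <- pairs a].

Lemma left_testE f a w s : Fam f w s -> (eval (left_test f a) s != 0) = ldesc a w.
Proof.
move=> fs; rewrite /left_test allxE all_map; apply: eq_in_all => p.
rewrite mem_pairs => /andP[np _]; apply: etrans (eqxE _ _ _) _ => /=.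
by have [-> _] := fs p np; rewrite enc_mod hd_codeE.
Qed.

Lemma right_testE f a w s : Fam f w s -> (eval (right_test f a) s != 0) = ldesc a (rev w).
Proof.
move=> fs; rewrite /right_test allxE all_map; apply: eq_in_all => p.
rewrite mem_pairs => /andP[np _]; apply: etrans (eqxE _ _ _) _ => /=.
by have [-> ->] := fs p np; rewrite enc_last_div hd_codeE /pr filter_rev.
Qed.

(** * Reading the words into reduced form *)

Definition letters : seq (letter n) := enum {: 'I_n * bool}.
Lemma mem_letters a : a \in letters. Proof. exact: mem_enum. Qed.

Definition mull_cmd f a := If (left_test f (linv a)) (pop_left f (linv a)) (push_left f a).

Lemma Fam_mull f a w s : Fam f w s -> Fam f (mull a w) (den (mull_cmd f a) s).
Proof.
move=> fs; rewrite /= /mull -(left_testE _ fs); case: eqP => /eqP h /=.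
  exact: Fam_push_left.
by apply: (Fam_pop_left _ fs); apply: ldescP; rewrite -(left_testE _ fs).
Qed.

Lemma mull_cmd_writes f a : all (in_fam f) (writes (mull_cmd f a)).
Proof. by rewrite /= all_cat !update_writes. Qed.

(** The code handling a letter depends on its list of pairs, fixed when the program is generated; a
    letter known only at run time selects its branch here. *)
Definition dispatch (c : letter n -> cmd) := seqs (fun a => If (eqx (Reg rD) (Const (code a))) (c a) Skip) letters.

Lemma den_seqs_cons (T : Type) (f : T -> cmd) x l s :
  den (seqs f (x :: l)) s = den (seqs f l) (den (f x) s).
Proof. by []. Qed.

Lemma den_if x k1 k2 s :
  den (If x k1 k2) s = if eval x s != 0 then den k1 s else den k2 s.
Proof. by rewrite [LHS]/=; case: eqP. Qed.

Lemma dispatch_miss (c : letter n -> cmd) s : s rD = 0 -> den (dispatch c) s = s.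
Proof.
rewrite /dispatch => D0; elim: letters => // a l IH.
by rewrite den_seqs_cons den_if eqxE /= D0 -/(seqs _ _).
Qed.

Lemma dispatch_hit (c : letter n -> cmd) s b : s rD = code b ->
  (forall a, rD \notin writes (c a)) -> den (dispatch c) s = den (c b) s.
Proof.
move=> Db nw; have : b \in letters := mem_letters b; have := enum_uniq {: 'I_n * bool}.
rewrite -/letters /dispatch; set f := fun a => _.
have fE a t : t rD = code b -> den (f a) t = if a == b then den (c a) t else t.
  move=> Dt; rewrite /f den_if eqxE [eval _ _]/= Dt [eval _ _]/=.
  by rewrite (inj_eq (@code_inj n)) eq_sym.
have miss l t : t rD = code b -> b \notin l -> den (seqs f l) t = t.
  move=> Dt; elim: l => // a l IH; rewrite inE negb_or => /andP[ba bl].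
  by rewrite den_seqs_cons fE // eq_sym (negPf ba) IH.
elim: letters => // a l IH /andP[al ul]; rewrite inE den_seqs_cons fE // eq_sym.
case: (eqVneq a b) al => [->|_] al /=; last exact: IH.
by move=> _; rewrite miss // den_frame.
Qed.

Lemma den_seq (c1 c2 : cmd) s : den (Seq c1 c2) s = den c2 (den c1 s). Proof. by []. Qed.
Lemma den_asg r x s : den (Asg r x) s = set_reg s r (eval x s). Proof. by []. Qed.

Lemma Fam_frame_neq f g w (c : cmd) s : all (in_fam f) (writes c) -> g != f ->
  Fam g w s -> Fam g w (den c s).
Proof.
move=> h gf; apply: Fam_frame; apply: sub_all h => -[|? [|b [|? [|? [|? ?]]]]] //=.
by case/andP=> -> /eqP ->; case: f g gf => -[].
Qed.

Definition clear_flags s := forall x, s (rF x) = 0.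

(** Letters leave [rX] from the last to the first, the order in which [nf] multiplies on the left.
    The loop has already decremented [rT], which is therefore the index of the current letter; it
    lies in the first word iff [rU - rT] is nonzero. *)
Definition read_body := Seq (Asg rD (Bin Mod (Reg rX) (Const radix)))
  (Seq (Asg rX (Bin Div (Reg rX) (Const radix)))
  (dispatch (fun a => If (Bin Sub (Reg rU) (Reg rT)) (mull_cmd true a) (mull_cmd false a)))).

Definition read_inv (u0 v0 : seq (letter n)) T k s :=
  [/\ s rX = num n (mkseq (letter_at u0 v0) k), s rU = size u0, s rC = T & clear_flags s] /\
  (Fam true (nf (drop k u0)) s /\ Fam false (nf (drop (k - size u0) v0)) s).

Lemma nf_drop k a u : k < size u -> nth a u k = a -> nf (drop k u) = mull a (nf (drop k.+1 u)).
Proof. by move=> h E; rewrite (drop_nth a h) E. Qed.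

Lemma read_body_spec u0 v0 T k s : s rT = k -> read_inv u0 v0 T k.+1 s ->
  read_inv u0 v0 T k (den read_body s).
Proof.
move=> sT [[sX sU sC sF] [fu fv]]; rewrite /read_body !den_seq !den_asg.
have lt := letter_at_lt u0 v0 k.
set s1 := set_reg s rD _; set s2 := set_reg s1 rX _; set c := fun a => _.
have fu2 : Fam true (nf (drop k.+1 u0)) s2 by do 2!apply: Fam_set => //.
have fv2 : Fam false (nf (drop (k.+1 - size u0) v0)) s2 by do 2!apply: Fam_set => //.
have D2 : s2 rD = letter_at u0 v0 k.
  by rewrite /s2 /s1 set_reg_neq // set_reg_eq /= sX mkseqS num_rcons modnMDl modn_small.
have X2 : s2 rX = num n (mkseq (letter_at u0 v0) k).
  by rewrite /s2 set_reg_eq /= /s1 set_reg_neq // sX mkseqS num_rcons divnMDl // divn_small ?addn0.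
have U2 : s2 rU = size u0 by rewrite /s2 /s1 !set_reg_neq.
have T2 : s2 rT = k by rewrite /s2 /s1 !set_reg_neq.
have C2 : s2 rC = T by rewrite /s2 /s1 !set_reg_neq.
have F2 : clear_flags s2 by move=> x; rewrite /s2 /s1 !set_reg_neq.
have nD a : rD \notin writes (c a).
  rewrite /c [writes _]/= !mem_cat !negb_or -!andbA.
  by apply/and4P; split; apply: contraT; rewrite negbK => /(allP (update_writes _ _ _ _)).
(* Indices beyond the input carry the digit 0, which matches no branch. *)
have [kN|Nk] := ltnP k (size u0 + size v0); last first.
  have D0 : s2 rD = 0 by rewrite D2 /letter_at nth_default // size_map size_cat.
  rewrite dispatch_miss //; split; first by split.
  by move: fu2 fv2; rewrite !drop_oversize; try lia; move=> *; split.
have [a Ea] : exists a, nth a (u0 ++ v0) k = a /\ letter_at u0 v0 k = code a.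
  rewrite /letter_at; case E : (u0 ++ v0) => [|b w0].
    by move: (congr1 size E) kN; rewrite size_cat /= => ->.
  have kE : k < size (b :: w0) by rewrite -E size_cat.
  exists (nth b (b :: w0) k); rewrite (nth_map b) //; split => //.
  exact: set_nth_default.
case: Ea => Ea Ca; rewrite (dispatch_hit (b := a)) // ?D2 // /c den_if.
have fr f r : in_fam f r = false -> den (mull_cmd f a) s2 r = s2 r.
  by move=> h; apply: den_only (mull_cmd_writes f a) _; rewrite h.
rewrite nth_cat in Ea; rewrite [eval _ _]/= U2 T2 subn_eq0 -ltnNge; case: ltnP Ea => ku Ea.
  split; first by split=> [|||x]; rewrite fr.
  have -> : k - size u0 = 0 by lia.
  move: fv2; rewrite (_ : k.+1 - size u0 = 0); last by lia.
  rewrite (nf_drop ku Ea); move/(Fam_frame_neq (mull_cmd_writes true a)) => h.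
  by split; [apply: Fam_mull|apply: h].
split; first by split=> [|||x]; rewrite fr.
have lv : k - size u0 < size v0 by lia.
rewrite (nf_drop lv Ea); move: fv2; rewrite subSn // => fv2.
split; last exact: Fam_mull.
move: fu2; rewrite !drop_oversize ?leqW // => /(Fam_frame_neq (mull_cmd_writes false a)).
exact.
Qed.

(** * Shrinking on the machine *)

Definition shrink_cmd f a := If (Bin Mul (Bin Mul (left_test f (phi a)) (right_test f (linv a)))
    (Bin Div (Reg (rM f (a.1, a.1))) (Const radix)))
  (Seq (pop_left f (phi a)) (pop_right f (linv a))) Skip.

Lemma shrink_cmd_writes f a : all (in_fam f) (writes (shrink_cmd f a)).
Proof. by rewrite /= !all_cat !update_writes. Qed.

Lemma rdescP a w : ldesc a (rev w) -> exists h, w =t h ++ [:: a].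
Proof.
move/ldescP => h; exists (rev (rem a (rev w))); apply: teq_revE; apply: teq_trans h _.
by rewrite rev_cat revK.
Qed.

(** The third factor of the test asks for a second letter at the vertex of [a]. Without it, one
    occurrence could pass both end tests, when [phi a] equals [linv a] and commutes with the
    rest. *)
Lemma shrink_cmd_spec f a w s : reduced w -> Fam f w s ->
  (den (shrink_cmd f a) s = s /\ ~ exists h, w =t phi a :: h ++ [:: linv a]) \/
  exists2 h, shrink w h & Fam f h (den (shrink_cmd f a) s).
Proof.
move=> rw fs; rewrite /shrink_cmd den_if !mulxE (left_testE _ fs) (right_testE _ fs).
have nn : ~~ e (a.1, a.1).1 (a.1, a.1).2 by rewrite e_irr.
have mm : meets (phi a) (a.1, a.1) by rewrite /meets phi1 eqxx.
have [sM _] := fs _ nn.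
have -> : eval (Bin Div (Reg (rM f (a.1, a.1))) (Const radix)) s = enc (behead (pr (a.1, a.1) w)).
  by rewrite /= sM enc_div.
rewrite enc_eq0; case: ifP => [/andP[/andP[/ldescP hl /rdescP[h hr]]] two|no].
  have := teq_trans (teq_sym hl) hr => /levi_mixed[[z [hz _]]|[hk _ hc]].
    right; exists z.
      split => //; exists a; apply: teq_trans hl _; exact: teq_cons.
    rewrite den_seq; apply: Fam_pop_right hz _; exact: Fam_pop_left hl _.
  case/negP: two; rewrite (hl _ nn) pr_cons mm (hk _ nn) [behead _]/=.
  have -> : pr (a.1, a.1) h = [::]; last by [].
  apply/eqP; rewrite pr_nil_allP; apply/hasPn => b /(allP hc); rewrite phi1 /meets orbb /=.
  by apply: contraTN => /eqP ->; rewrite e_irr.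
left; split => // -[h hw]; move/negP: no; apply.
rewrite (ldesc_cons hw) /=; apply/andP; split.
  apply: (@ldesc_cons _ _ (rev (phi a :: h))).
  by apply: teq_revE; rewrite revK; apply: teq_trans hw _; rewrite rev_cons revK -cats1.
rewrite (hw _ nn) pr_cons mm pr_cat pr_cons [behead _]/= /meets eqxx.
by case: (pr _ h).
Qed.

Definition shrink_body := seqs (fun f => seqs (shrink_cmd f) letters) [:: true; false].

Definition irr w := irreducible shrink w.

Lemma shrinks_cmd_spec f l w s : reduced w -> Fam f w s ->
  (den (seqs (shrink_cmd f) l) s = s /\ forall a, a \in l -> ~ exists h, w =t phi a :: h ++ [:: linv a]) \/
  exists h, [/\ clos_refl_trans_1n _ shrink w h, Fam f h (den (seqs (shrink_cmd f) l) s),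
     reduced h & size h < size w].
Proof.
elim: l w s => [|a l IH] w s rw fs; first by left; split.
rewrite den_seqs_cons; case: (shrink_cmd_spec a rw fs) => [[-> na]|[h wh fh]].
  case: (IH w s rw fs) => [[-> nl]|H]; [left|by right].
  by split => // b; rewrite inE => /predU1P[->|/nl].
have rh := shrink_reduced wh; have lt := shrink_size wh; right.
case: (IH h _ rh fh) => [[-> _]|[k [hk fk rk lk]]].
  exists h; split => //; apply: Relation_Operators.rt1n_trans wh _.
  exact: Relation_Operators.rt1n_refl.
by exists k; split => //; [apply: Relation_Operators.rt1n_trans wh hk|apply: ltn_trans lt].
Qed.

(** [k] is the number of rounds left. A round that removes nothing certifies irreducibility and any
    other shortens the word, so length at most [k] is enough. *)
Definition shrunk f w0 k s := exists w, [/\ clos_refl_trans_1n _ shrink w0 w, reduced w,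
  Fam f w s & irr w \/ size w <= k].

Lemma shrunk_step f w0 k s : shrunk f w0 k.+1 s ->
  shrunk f w0 k (den (seqs (shrink_cmd f) letters) s).
Proof.
move=> [w [hw rw fw iw]].
case: (shrinks_cmd_spec letters rw fw) => [[-> nl]|[h [wh fh rh lh]]].
  by exists w; split => //; left => h [_ [a ha]]; apply: (nl a (mem_letters a)); exists h.
exists h; split => //; last first.
  case: iw => [iw|le]; last by right; lia.
  by case: wh lh => [|h1 h2 /iw//]; rewrite ltnn.
by elim: hw wh => // x y z xy _ IH /IH h'; apply: Relation_Operators.rt1n_trans xy h'.
Qed.

Lemma shrunk_frame f g w0 k s (c : cmd) : all (in_fam g) (writes c) -> f != g ->
  shrunk f w0 k s -> shrunk f w0 k (den c s).
Proof.
by move=> hc fg [w [h1 h2 h3 h4]]; exists w; split => //; apply: Fam_frame_neq hc fg h3.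
Qed.

Lemma shrunk0 f w0 s : shrunk f w0 0 s -> exists2 w, normalizes shrink w0 w & Fam f w s.
Proof.
move=> [w [hw rw fw iw]]; exists w => //; split => //; case: iw => // w0' h wh.
by have := shrink_size wh; lia.
Qed.

(** * Rotating one word onto the other *)

Definition flags s := [set x | s (rF x) != 0].

(** The last clause says that no flag is wasted: its vertex really has to be rotated along [t]. With
    the support clause, it also occurs in [g]. *)
Definition target (g q t : seq (letter n)) s := [/\ g ++ map phi t =t t ++ q,
  forall x, 0 < cnt x t -> 0 < cnt x g & forall x, x \in flags s -> 0 < cnt x t].

(** A rotation clears one flag, which costs 1, and shortens [t], which has to gain more; hence the
    weight 2. Setting a flag gains 1. *)
Definition potential (t : seq (letter n)) s := 2 * size t + (n - #|flags s|).

Definition ncpairs : seq ('I_n * 'I_n) := [seq p <- enum {: 'I_n * 'I_n} | ~~ e p.1 p.2].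
Lemma mem_ncpairs p : (p \in ncpairs) = ~~ e p.1 p.2.
Proof. by rewrite mem_filter mem_enum andbT. Qed.

Definition is_flag (r : reg) := if r is [:: k; _] then k == 5 else false.

(** Only the flag of [p.1] is consulted, as [ncpairs] lists both orders of a pair. This disjunct
    flags the letter that blocks a flagged vertex. *)
Definition mark_cmd p a := If (Bin Mul (eqx (headx true p) (Const (code a)))
    (Bin Add (neqx (Reg (rM true p)) (Reg (rM false p))) (Reg (rF p.1))))
  (Asg (rF a.1) (Const 1)) Skip.

Definition marks p a g q s := (ohead (pr p g) == Some a) && ((pr p g != pr p q) || (p.1 \in flags s)).

Lemma flags_set s (x : 'I_n) k : flags (set_reg s (rF x) k) = if k == 0 then flags s :\ x else x |: flags s.
Proof.
apply/setP => y; rewrite inE /set_reg rF_eq.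
by case: (k =P 0) => [->|/eqP k0]; rewrite !inE; case: (y =P x).
Qed.

Lemma den_mark p a g q s : ~~ e p.1 p.2 -> Fam true g s -> Fam false q s ->
  den (mark_cmd p a) s = if marks p a g q s then set_reg s (rF a.1) 1 else s.
Proof.
move=> np fg fq; rewrite /mark_cmd den_if mulxE eqxE /marks.
have [Mg _] := fg p np; have [Mq _] := fq p np.
have -> : (eval (headx true p) s == eval (Const (code a)) s) = (ohead (pr p g) == Some a).
  by rewrite /= Mg enc_mod hd_codeE.
have -> : (eval (Bin Add (neqx (Reg (rM true p)) (Reg (rM false p))) (Reg (rF p.1))) s != 0) =
    (pr p g != pr p q) || (p.1 \in flags s).
  have := neqxE (Reg (rM true p)) (Reg (rM false p)) s; rewrite inE /= Mg Mq.
  by rewrite (inj_eq enc_inj) => <-; rewrite addn_eq0 negb_and.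
by [].
Qed.

(** If [t] has letters on [p], the first of them is the first letter of [g] there. If it has none,
    [g] and [q] agree on [p] and [p.1] is not flagged, so there is no reason to mark. *)
Lemma mark_target p a g q t s : ~~ e p.1 p.2 -> marks p a g q s ->
  target g q t s -> 0 < cnt a.1 t.
Proof.
move=> np /andP[/eqP hd cond] [ht _ fl]; have := ht p np; rewrite !pr_cat pr_phi.
case Et : (pr p t) => [|b t1].
  rewrite cats0 => Egq; case/orP: cond => [/eqP[]//|/fl].
  by rewrite -(@cnt_pr p.1 p) ?eqxx // Et.
case: (pr p g) hd => //= _ g1 [->] [-> _].
have : b \in t by have : b \in pr p t by [rewrite Et mem_head]; rewrite mem_filter => /andP[].
by move=> bt; rewrite -has_count; apply/hasP; exists b.
Qed.

Lemma Fam_flag f w s (x : 'I_n) k : Fam f w s -> Fam f w (set_reg s (rF x) k).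
Proof. exact: Fam_set. Qed.

(** Flags only grow during the pass, so every mark due at its start is made, whatever the order of
    [l]. *)
Lemma marks_spec (l : seq (('I_n * 'I_n) * letter n)) g q s :
  (forall z, z \in l -> ~~ e z.1.1 z.1.2) -> Fam true g s -> Fam false q s ->
  let s' := den (seqs (fun z => mark_cmd z.1 z.2) l) s in
  [/\ Fam true g s', Fam false q s', flags s \subset flags s',
      forall p a, (p, a) \in l -> marks p a g q s -> a.1 \in flags s' &
      forall t, target g q t s -> target g q t s'].
Proof.
elim: l s => [|[p a] l IH] s nl fg fq /=; first by split.
rewrite -/(seqs _ _) -/(mark_cmd p a) -[X in den _ X]/(den (mark_cmd p a) s).
have np : ~~ e p.1 p.2 by apply: (nl (p, a)); rewrite mem_head.
rewrite (den_mark a np fg fq); set s1 := if _ then _ else _.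
have fl1 : flags s1 = if marks p a g q s then a.1 |: flags s else flags s.
  by rewrite /s1; case: ifP => // _; rewrite flags_set.
have sub : flags s \subset flags s1 by rewrite fl1; case: ifP => // _; apply: subsetUr.
have [|||f1 f2 f3 f4 f5] := IH s1.
- by move=> z zl; apply: nl; rewrite inE zl orbT.
- by rewrite /s1; case: ifP => // _; apply: Fam_flag.
- by rewrite /s1; case: ifP => // _; apply: Fam_flag.
split => //; first exact: subset_trans f3.
- move=> p' a'; rewrite inE => /predU1P[[-> ->]|pl] m.
    by apply: (subsetP f3); rewrite fl1 m in_setU1 eqxx.
  apply: (f4 p') => //; case/andP: m => hd /orP[neq|p1]; rewrite /marks hd ?neq //=.
  by rewrite (subsetP sub) // orbT.
- move=> t Ht; apply: f5; case: (Ht) => h1 h2 h3; split => // x; rewrite fl1.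
  case: ifP => [m|_]; last exact: h3.
  by rewrite in_setU1 => /predU1P[->|/h3 //]; apply: mark_target np m Ht.
Qed.

Definition sweep_cmd a := If (Bin Mul (Reg (rF a.1)) (left_test true a))
  (Seq (pop_left true a) (Seq (push_right true (phi a)) (Asg (rF a.1) (Const 0)))) Skip.

(** The vertex of [a] is flagged, so [t] is nonempty on every pair meeting it and starts there as
    [g] does, with [a]. So [a] can be cut off the front of [t]. *)
Lemma rotate_target a g h q t s s' : g =t a :: h -> a.1 \in flags s ->
  flags s' = flags s :\ a.1 -> target g q t s ->
  exists t', [/\ target (h ++ [:: phi a]) q t' s', size t' <= size t & potential t' s' < potential t s].
Proof.
move=> hg fa fs' [ht sup fl].
have /ldescP tt : ldesc a t.
  apply/allP => p; rewrite mem_pairs => /andP[np ap].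
  have := ht p np; rewrite !pr_cat (hg p np) pr_cons ap.
  case Et : (pr p t) => [|b t1] /=; last by case=> ->.
  by have := fl _ fa; rewrite -(@cnt_pr a.1 p) // Et.
set t' := rem a t in tt; have st := teq_size tt; rewrite /= in st.
have cg x : cnt x (h ++ [:: phi a]) = cnt x g.
  by rewrite (cnt_teq x hg) cnt_cat /cnt /= phi1 addn0 addnC.
have ct x : cnt x t = (a.1 == x) + cnt x t' by rewrite (cnt_teq x tt).
exists t'; split.
- split.
  + apply: (@teq_cons_inj a).
    apply: (@teq_trans (g ++ map phi t)).
      apply: teq_sym; apply: teq_trans (teq_cat hg (teq_phi tt)) _.
      by rewrite /= -catA.
    by apply: teq_trans ht _; rewrite -cat_cons; apply: teq_catr.
  + by move=> x x0; rewrite cg; apply: sup; rewrite ct ltn_addl.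
  + move=> x; rewrite fs' in_setD1 => /andP[xa /fl]; rewrite ct.
    by rewrite eq_sym (negPf xa).
- by rewrite st.
- have := cardsD1 a.1 (flags s); rewrite fa /potential st fs' => Ec.
  have : #|flags s| <= n by rewrite -[n in _ <= n]card_ord max_card.
  by move: Ec; set A := #|_|; set B := #|_|; lia.
Qed.

Lemma sweep_spec a g q s : Fam true g s -> Fam false q s ->
  (den (sweep_cmd a) s = s /\ ~~ ((a.1 \in flags s) && ldesc a g)) \/
  exists g', [/\ Fam true g' (den (sweep_cmd a) s), Fam false q (den (sweep_cmd a) s), rotate g g' &
    forall t, target g q t s -> exists t', [/\ target g' q t' (den (sweep_cmd a) s),
      size t' <= size t & potential t' (den (sweep_cmd a) s) < potential t s]].
Proof.
move=> fg fq; rewrite /sweep_cmd den_if mulxE (left_testE _ fg).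
have -> : (eval (Reg (rF a.1)) s != 0) = (a.1 \in flags s) by rewrite inE.
case: ifP => [/andP[fa la]|_]; [right|by left].
rewrite !den_seq den_asg; set s1 := den _ s; set s2 := den _ s1; have hg := ldescP la.
have f2 : Fam true (rem a g ++ [:: phi a]) s2.
  by apply: Fam_push_right; apply: Fam_pop_left hg fg.
have q2 : Fam false q s2.
  apply: (Fam_frame_neq (f := true)) => //; first exact: update_writes.
  by apply: (Fam_frame_neq (f := true)) fq => //; apply: update_writes.
have fl2 : flags s2 = flags s.
  by apply/setP => x; rewrite !inE /s2 /s1 !(den_only (Q := in_fam true)) ?update_writes.
exists (rem a g ++ [:: phi a]); split.
- exact: Fam_flag.
- exact: Fam_flag.
- by exists a, (rem a g).
- by move=> t; apply: rotate_target hg fa _; rewrite flags_set fl2.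
Qed.

Lemma sweeps_spec l g q s : Fam true g s -> Fam false q s ->
  let s' := den (seqs sweep_cmd l) s in
  (s' = s /\ forall a, a \in l -> ~~ ((a.1 \in flags s) && ldesc a g)) \/
  exists g', [/\ Fam true g' s', Fam false q s', twisted_conj e xs g g' &
    forall t, target g q t s -> exists t', [/\ target g' q t' s',
      size t' <= size t & potential t' s' < potential t s]].
Proof.
elim: l g s => [|a l IH] g s fg fq /=; first by left.
rewrite -/(seqs _ _) -[X in den _ X]/(den (sweep_cmd a) s).
case: (sweep_spec a fg fq) => [[-> na]|[h [fh fq1 gh Hh]]].
  case: (IH g s fg fq) => [[-> nl]|H]; last by right.
  by left; split => // b; rewrite inE => /predU1P[->|/nl].
right; case: (IH h _ fh fq1) => [[-> nl]|[k [fk fq2 hk Hk]]].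
  by exists h; split => //; apply: rotate_twisted_conj.
exists k; split => //; first exact: twisted_conj_trans (rotate_twisted_conj gh) hk.
move=> t /Hh[t1 [/Hk[t2 [h1 h2 h3]] h4 h5]]; exists t2; split => //.
  exact: leq_trans h4.
exact: ltn_trans h5.
Qed.

Definition match_body := Seq
  (seqs (fun z => mark_cmd z.1 z.2) [seq (p, a) | p <- ncpairs, a <- letters])
  (seqs sweep_cmd letters).

(* The leftmost flagged letter of [g] is a left descent, as a letter in front of a
   flagged one is flagged too. *)
Lemma stuck_matched g q t s : target g q t s ->
  (forall p a, ~~ e p.1 p.2 -> marks p a g q s -> a.1 \in flags s) ->
  (forall a, ~~ ((a.1 \in flags s) && ldesc a g)) -> target g q [::] s.
Proof.
move=> [ht sup fl] closed stuck.
have F0 x : (x \in flags s) = false.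
  apply: negbTE; apply/negP => xF.
  have : has (fun a => a.1 \in flags s) g.
    have /hasP[a ag /eqP ax] : has (fun a => a.1 == x) g by rewrite has_count; apply/sup/fl.
    by apply/hasP; exists a; rewrite ?ax.
  move Eg: g => g0 hg0; case/split_find: hg0 Eg => a s1 s2 aF /hasPn n1.
  rewrite cat_rcons => Eg; case/negP: (stuck a); rewrite aF.
  apply/allP => p; rewrite mem_pairs => /andP[np ap].
  (* [marks] looks at the flag of the first component, so the pair is turned to have [a.1] there. *)
  have [p' [np' p'1 <-]] : exists p', [/\ ~~ e p'.1 p'.2, p'.1 = a.1 & pr p' g = pr p g].
    case/orP: ap => /eqP Ea; first by exists p.
    exists (p.2, p.1); split => //=; first by rewrite e_sym.
    by apply: eq_filter => b; rewrite /meets orbC.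
  rewrite Eg pr_cat; case E1 : (pr p' s1) => [|b r].
    by rewrite cat0s pr_cons /meets p'1 eqxx.
  have : b \in pr p' s1 by rewrite E1 mem_head.
  rewrite mem_filter => /andP[_ /n1 /negP[]]; apply: (closed p') => //.
  by rewrite /marks Eg pr_cat E1 /= eqxx p'1 aF orbT.
split => // [p np|x]; last by rewrite F0.
rewrite cats0; apply/eqP; apply: contraT => neq.
case E : (pr p g) => [|b r].
  have /(congr1 size) := ht p np; rewrite !pr_cat pr_phi !size_cat size_map E /= addnC.
  move=> Es; have /size0nil Eq : size (pr p q) = 0 by lia.
  by rewrite E Eq in neq.
by rewrite -(F0 b.1) (closed p) // /marks E /= eqxx -E neq.
Qed.

(** A round that rotates lowers the potential, and so does one that only adds flags. If neither
    happens, the situation is stuck and the words already agree. *)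
Lemma match_body_spec g q s : Fam true g s -> Fam false q s ->
  let s' := den match_body s in
  exists g', [/\ Fam true g' s', Fam false q s', twisted_conj e xs g g' &
    forall t, target g q t s -> exists t', [/\ target g' q t' s', size t' <= size t &
      potential t' s' < potential t s \/ target g' q [::] s']].
Proof.
move=> fg fq; rewrite /match_body den_seq.
set l := flatten _.
have [|fg1 fq1 sub cl H1] := @marks_spec l g q s _ fg fq.
  by move=> z /allpairsP[[p a] [/= pn _ ->]] /=; rewrite -mem_ncpairs.
set s1 := den _ s in fg1 fq1 sub cl H1 *.
have card x : #|flags x| <= n by rewrite -[n in _ <= n]card_ord max_card.
have pot t : potential t s1 <= potential t s.
  by rewrite leq_add2l leq_sub2l // subset_leq_card.
case: (sweeps_spec letters fg1 fq1) => [[-> nl]|[g' [fg2 fq2 gg H2]]]; last first.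
  exists g'; split => // t /H1/H2[t' [h1 h2 h3]]; exists t'; split => //.
  by left; apply: leq_trans h3 _; apply: pot.
exists g; split => //; first exact/twisted_conj_raag/raag_refl.
move=> t /[dup] Ht /H1 Ht1; exists t; split => //.
have [E|ne] := eqVneq (flags s) (flags s1); [right|left].
  apply: (stuck_matched Ht1) => [p a np m|a]; last exact: nl (mem_letters a).
  by apply: (cl p a); [apply: allpairs_f; [rewrite mem_ncpairs|apply: mem_letters]|rewrite /marks E].
have : #|flags s| < #|flags s1| by apply: proper_card; rewrite properEneq ne.
by rewrite /potential; have := card s1; lia.
Qed.

(** Conjugacy to [g0] is unconditional and serves soundness; the witness [t] depends on
    [forward g0 q] and serves completeness. Success needs its own alternative, since an empty [t]
    leaves no flags and has potential [n]. *)
Definition matching g0 q k s := exists g, [/\ Fam true g s, Fam false q s, twisted_conj e xs g0 g &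
  forward g0 q -> exists t, target g q t s /\ (potential t s <= k \/ t = [::])].

Lemma match_step g0 q k s : matching g0 q k.+1 s -> matching g0 q k (den match_body s).
Proof.
move=> [g [fg fq gg H]]; have [g' [fg' fq' gg' H']] := match_body_spec fg fq.
exists g'; split => //; first exact: twisted_conj_trans gg'.
move=> /H[t [/H'[t' [h1 h2 h3]] h4]].
case: h4 h2 h3 => [le _|-> /=]; last by rewrite leqn0 => /nilP E _; exists t'; rewrite E in h1 *; split => //; right.
case=> [lt|h]; last by exists [::]; split => //; right.
by exists t'; split => //; left; lia.
Qed.

Lemma matching0 g0 q s : matching g0 q 0 s -> exists g, [/\ Fam true g s, Fam false q s,
  twisted_conj e xs g0 g & forward g0 q -> g =t q].
Proof.
move=> [g [fg fq gg H]]; exists g; split => // /H[t [[ht _ _] h]].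
have Et : t = [::] by case: h => //; rewrite leqn0 addn_eq0 muln_eq0 /= => /andP[/nilP].
by rewrite Et cats0 in ht.
Qed.

(** * The whole decision procedure and its cost *)

Lemma loopfree_update f l xM xP : loopfree (update f l xM xP).
Proof. by apply: loopfree_seqs. Qed.

Lemma mull_size a w : size (mull a w) <= (size w).+1.
Proof. by case: mullP => // h /teq_size ->; rewrite /= ltnW. Qed.
Lemma nf_size w : size (nf w) <= size w.
Proof. by elim: w => //= a w IH; apply: leq_trans (mull_size a _) _. Qed.
Lemma shrinks_size g h : clos_refl_trans_1n _ shrink g h -> size h <= size g.
Proof. by elim=> // x y z /shrink_size h1 _ h2; apply: leq_trans h2 (ltnW h1). Qed.

(** Memory may still hold input cells, so projections and flags are set explicitly. [rC] keeps the
    total count, because the reading loop uses up [rT]. *)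
Definition init_cmd := Seq (Asg rC (Reg rT))
  (Seq (seqs (fun f => update f ncpairs (fun _ => Const 0) (fun _ => Const 1)) [:: true; false])
       (seqs (fun x => Asg (rF x) (Const 0)) (enum 'I_n))).

Lemma Fam_init f s : Fam f [::] (den (update f ncpairs (fun _ => Const 0) (fun _ => Const 1)) s).
Proof.
move=> p np.
have [||-> ->] := @update_den f ncpairs (fun _ => Const 0) (fun _ => Const 1)
  (fun _ _ => 0) (fun _ => 1) s (filter_uniq _ (enum_uniq _)) _ _ p; rewrite // mem_ncpairs np.
by [].
Qed.

Lemma den_clear l s x :
  den (seqs (fun x => Asg (rF x) (Const 0)) l) s (rF x) = if x \in l then 0 else s (rF x).
Proof.
elim: l s => // y l IH s; rewrite den_seqs_cons IH den_asg inE /set_reg rF_eq /=.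
by case: (x =P y); case: ifP.
Qed.

Lemma init_spec s u0 v0 T : size u0 + size v0 <= T ->
  s rX = num n (mkseq (letter_at u0 v0) T) -> s rU = size u0 -> s rT = T ->
  read_inv u0 v0 T T (den init_cmd s) /\ den init_cmd s rT = T.
Proof.
move=> le sX sU sT; rewrite /init_cmd den_seq den_asg den_seq.
set s1 := set_reg s rC _; set s2 := den _ s1; set c := seqs _ (enum _).
have wc : all is_flag (writes c) by apply: writes_seqs.
have F2 f : Fam f [::] s2.
  rewrite /s2 !den_seqs_cons [den (seqs _ _) _]/=; set s3 := den _ s1.
  case: f; last exact: Fam_init.
  apply: (Fam_frame_neq (f := false)) => //; first exact: update_writes.
  exact: Fam_init.
have fr r : ~~ is_flag r -> ~~ in_fam true r -> ~~ in_fam false r -> den c s2 r = s1 r.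
  move=> h1 h2 h3; rewrite (den_only _ wc h1) /s2 !den_seqs_cons [den (seqs _ _) _]/=.
  by rewrite !(den_only _ (update_writes _ _ _ _)).
have Fc f : Fam f [::] (den c s2).
  by apply: Fam_frame (F2 f); apply: sub_all wc => -[|? [|? [|? ?]]].
split; last by rewrite fr // set_reg_neq.
split; last by rewrite !drop_oversize //; lia.
split; rewrite ?fr ?set_reg_neq ?set_reg_eq //.
by move=> x; rewrite den_clear mem_enum.
Qed.

Definition final_cmd := Asg rX (allx [seq eqx (Reg (rM true p)) (Reg (rM false p)) | p <- ncpairs]).

Lemma final_spec g q s : Fam true g s -> Fam false q s ->
  den final_cmd s rX != 0 <-> g =t q.
Proof.
move=> fg fq; rewrite /final_cmd den_asg set_reg_eq allxE all_map.
rewrite (@eq_in_all _ _ (fun p => pr p g == pr p q)) => [|p]; last first.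
  rewrite mem_ncpairs => np; apply: etrans (eqxE _ _ _) _ => /=.
  by have [-> _] := fg p np; have [-> _] := fq p np; rewrite (inj_eq enc_inj).
split=> [/allP h p np|h]; first by apply/eqP/h; rewrite mem_ncpairs.
by apply/allP => p; rewrite mem_ncpairs => /h ->.
Qed.

(** The last loop count bounds the initial potential: [t] has at most [n + 4] times as many letters
    as [g], each of weight 2, and [n] flags are unset. *)
Definition decide_cmd := Seq init_cmd (Seq (Loop rT read_body) (Seq (Asg rT (Reg rC))
  (Seq (Loop rC shrink_body) (Seq
    (Asg rC (Bin Add (Bin Mul (Reg rT) (Const (2 * (n + 4)))) (Const n)))
  (Seq (Loop rC match_body) final_cmd))))).

Definition shrink_inv (u0 v0 : seq (letter n)) T k s :=
  [/\ shrunk true (nf u0) k s, shrunk false (nf v0) k s, s rT = T & clear_flags s].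

Lemma shrink_body_writes : all [predU in_fam true & in_fam false] (writes shrink_body).
Proof.
apply: writes_seqs => f; apply: writes_seqs => a; apply: sub_all (shrink_cmd_writes f a) => r.
by case: f => h; apply/orP; [left|right].
Qed.

Lemma shrink_body_spec u0 v0 T k s : shrink_inv u0 v0 T k.+1 s ->
  shrink_inv u0 v0 T k (den shrink_body s).
Proof.
move=> [h1 h2 h3 h4].
have w f : all (in_fam f) (writes (seqs (shrink_cmd f) letters)).
  by apply: writes_seqs => a; apply: shrink_cmd_writes.
split.
- rewrite /shrink_body !den_seqs_cons [den (seqs _ [::]) _]/=.
  by apply: (shrunk_frame (w false)) => //; apply: shrunk_step.
- rewrite /shrink_body !den_seqs_cons [den (seqs _ [::]) _]/=.
  by apply: shrunk_step; apply: (shrunk_frame (w true)).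
- by rewrite (den_only _ shrink_body_writes).
- by move=> x; rewrite (den_only _ shrink_body_writes).
Qed.

Lemma match_body_writes : all [predU in_fam true & is_flag] (writes match_body).
Proof.
rewrite [writes _]/= all_cat; apply/andP; split; first by apply: writes_seqs.
apply: writes_seqs => a; rewrite [writes _]/= cats0 !all_cat /= andbT.
by apply/andP; split; apply: sub_all (update_writes _ _ _ _) => r h; apply/orP; left.
Qed.

Lemma loopfree_read : loopfree read_body.
Proof. by apply: loopfree_seqs => a /=; rewrite !loopfree_update. Qed.
Lemma loopfree_shrink : loopfree shrink_body.
Proof. by do 2!apply: loopfree_seqs => ?; rewrite /= !loopfree_update. Qed.
Lemma loopfree_match : loopfree match_body.
Proof.
apply/andP; split; first exact: loopfree_seqs.
by apply: loopfree_seqs => a; rewrite /= !loopfree_update.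
Qed.
Lemma loopfree_init : loopfree init_cmd.
Proof.
rewrite /= !loopfree_update /=.
exact: (@loopfree_seqs _ (fun x => Asg (rF x) (Const 0))).
Qed.

Lemma read_body_writes : rT \notin writes read_body.
Proof.
rewrite [writes _]/= !inE /=; apply/negP => /(allP (_ : all [predU in_fam true & in_fam false] _)) h.
have /h // : all [predU in_fam true & in_fam false] (writes (dispatch (fun a : letter n =>
  If (Bin Sub (Reg rU) (Reg rT)) (mull_cmd true a) (mull_cmd false a)))).
apply: writes_seqs => a; rewrite [writes _]/= cats0 !all_cat.
by apply/andP; split; apply/andP; split; apply: sub_all (update_writes _ _ _ _) => r hr;
  apply/orP; [left|left|right|right].
Qed.

Lemma shrink_inv_set u0 v0 T k s (x : nat) : shrink_inv u0 v0 T k s ->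
  shrink_inv u0 v0 T k (set_reg s rC x).
Proof.
move=> [[u1 [h1 h2 h3 h4]] [v1 [k1 k2 k3 k4]] hT hF]; split.
- by exists u1; split => //; apply: Fam_set.
- by exists v1; split => //; apply: Fam_set.
- by rewrite set_reg_neq.
- by move=> y; rewrite set_reg_neq.
Qed.

Lemma matching_set g q k s (x : nat) : matching g q k s -> matching g q k (set_reg s rC x).
Proof.
by move=> [h [h1 h2 h3 h4]]; exists h; split => //; exact: Fam_set.
Qed.

Lemma decide_exec : exists K0 K1, forall (u v : seq (letter n)) T s,
  size u + size v <= T -> s rX = num n (mkseq (letter_at u v) T) -> s rU = size u -> s rT = T ->
  exists s' k, [/\ exec decide_cmd s s' k, s' rX != 0 <-> twisted_conj e xs u v & k <= K0 + K1 * T].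
Proof.
pose c1 := Asg rT (Reg rC).
pose c2 := Asg rC (Bin Add (Bin Mul (Reg rT) (Const (2 * (n + 4)))) (Const n)).
exists (cost init_cmd + cost c1 + cost c2 + cost final_cmd + n * (cost match_body + 5) + 3).
exists (cost read_body + 5 + (cost shrink_body + 5) + 2 * (n + 4) * (cost match_body + 5)).
move=> u v T s le sX sU sT.
have [h1 T1] := init_spec le sX sU sT.
have [k1 e1 l1] := exec_den s loopfree_init; set s1 := den init_cmd s in h1 T1 e1.
have [|k t x h|k t kt||s2 [k2 [e2 h2 l2]]] := @exec_loop rT read_body (read_inv u v T) s1 loopfree_read.
- exact: read_body_writes.
- case: h => [[? ? ? ?] [? ?]]; split; last by split; apply: Fam_set.
  by split; rewrite ?set_reg_neq // => y; rewrite set_reg_neq.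
- exact: read_body_spec.
- by rewrite T1.
rewrite T1 in l2; case: h2 => -[_ _ C2 F2]; rewrite !drop0 => -[fu2 fv2].
have [k3 e3 l3] := @exec_den c1 s2 isT; set s3 := den c1 s2 in e3.
have h3 : shrink_inv u v T (s3 rC) s3.
  have -> : s3 rC = T by rewrite /s3 /c1 den_asg set_reg_neq.
  split; last by move=> x; rewrite /s3 /c1 den_asg set_reg_neq.
  - exists (nf u); split; [exact: Relation_Operators.rt1n_refl|exact: nf_reduced|exact: Fam_set|].
    by right; apply: leq_trans (nf_size u) _; lia.
  - exists (nf v); split; [exact: Relation_Operators.rt1n_refl|exact: nf_reduced|exact: Fam_set|].
    by right; apply: leq_trans (nf_size v) _; lia.
  - by rewrite /s3 /c1 den_asg set_reg_eq /= C2.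
have C3 : s3 rC = T by rewrite /s3 /c1 den_asg set_reg_neq.
have [|k t x|k t _||s4 [k4 [e4 [s4u s4v T4 F4] l4]]] :=
    @exec_loop rC shrink_body (shrink_inv u v T) s3 loopfree_shrink.
- by apply/negP => /(allP shrink_body_writes).
- exact: shrink_inv_set.
- exact: shrink_body_spec.
- exact: h3.
rewrite C3 in l4.
have [g ng fg] := shrunk0 s4u; have [q nq fq] := shrunk0 s4v.
have [k5 e5 l5] := @exec_den c2 s4 isT; set s5 := den c2 s4 in e5.
have C5 : s5 rC = T * (2 * (n + 4)) + n by rewrite /s5 /c2 den_asg set_reg_eq /= T4.
have F5 : flags s5 = set0.
  by apply/setP => x; rewrite !inE /s5 /c2 den_asg set_reg_neq // F4.
have h5 : matching g q (s5 rC) s5.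
  exists g; split; try exact: Fam_set.
    exact/twisted_conj_raag/raag_refl.
  move=> /forward_bounded[t ht bt]; exists t; split.
    split => // x; last by rewrite F5 inE.
    by move=> x0; have := bt x; case: (posnP (cnt x g)) => // ->; rewrite muln0; lia.
  have tg : size t <= (n + 4) * size g.
    by rewrite (size_cnt t) (size_cnt g) big_distrr; apply: leq_sum.
  have gT : (n + 4) * size g <= (n + 4) * T.
    rewrite leq_mul2l; apply/orP; right; apply: leq_trans (shrinks_size ng.1) _.
    by apply: leq_trans (nf_size u) _; lia.
  left; rewrite /potential F5 cards0 subn0 C5 leq_add2r mulnCA leq_mul2l /= mulnC.
  exact: leq_trans tg _.
have [|k t x|k t _||s6 [k6 [e6 h6 l6]]] := @exec_loop rC match_body (matching g q) s5 loopfree_match.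
- by apply/negP => /(allP match_body_writes).
- exact: matching_set.
- exact: match_step.
- exact: h5.
have [g' [fg' fq' gg' Hg']] := matching0 h6.
have [k7 e7 l7] := @exec_den final_cmd s6 isT.
exists (den final_cmd s6), (k1 + (k2 + (k3 + (k4 + (k5 + (k6 + k7)))))); split.
- apply: ExecSeq e1 _; apply: ExecSeq e2 _; apply: ExecSeq e3 _; apply: ExecSeq e4 _.
  by apply: ExecSeq e5 _; apply: ExecSeq e6 _.
(* Equality is sound since [g'] was reached from [u] by twisted conjugations. Conversely, confluence
   turns conjugacy into [forward g q], the premise of the invariant. *)
- rewrite (final_spec fg' fq'); split => [gq|uv].
    have ug : twisted_conj e xs u g'.
      apply: twisted_conj_trans gg'; apply: twisted_conj_trans (shrinks_twisted_conj ng.1).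
      exact: twisted_conj_raag (raag_sym (nf_raag u)).
    have vq : twisted_conj e xs v q.
      apply: twisted_conj_trans (shrinks_twisted_conj nq.1).
      exact: twisted_conj_raag (raag_sym (nf_raag v)).
    apply: twisted_conj_trans ug _; apply: twisted_conj_trans (twisted_conj_sym vq).
    exact/twisted_conj_raag/teq_raag.
  exact/Hg'/(twisted_conj_plateau uv ng nq).
- rewrite C5 in l6; move: l1 l2 l3 l4 l5 l6 l7.
  set a := cost init_cmd; set b := cost read_body; set c := cost shrink_body.
  set d := cost match_body; set f := cost final_cmd; set x1 := cost c1; set x2 := cost c2.
  move=> l1 l2 l3 l4 l5 l6 l7; apply: leq_trans (_ : a + (T * (b + 5) + 1 + (x1 + (T * (c + 5) + 1 +
    (x2 + ((T * (2 * (n + 4)) + n) * (d + 5) + 1 + f))))) <= _).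
    by do 6?[apply: leq_add => //].
  by rewrite mulnDl -mulnA; nia.
Qed.

End Traces.

(** * The machine program *)

Definition output : seq instr := [:: IConst (tmp 0) 0; IAdd 0 (adr rX) (tmp 0)].

(** The addresses 22, 29 and 32 come from the lengths 22, 7 and 3 of the first pieces; the jumps in
    [append] rely on them. *)
Lemma program_code n D : let P := pack n ++ append ++ transfer ++ D ++ output ++ [:: IHalt] in
  [/\ code_at P 0 (pack n), code_at P 22 append, code_at P 29 transfer, code_at P 32 D &
      code_at P (32 + size D) output /\ code_at P (32 + size D + 2) [:: IHalt]].
Proof.
move=> P; split.
- exact: (@code_at_mid [::]).
- exact: (@code_at_mid (pack n)).
- exact: (@code_at_mid (pack n ++ append)).
- exact: (@code_at_mid (pack n ++ append ++ transfer)).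
apply: code_at_cat; have -> : 32 + size D = size ((pack n ++ append ++ transfer) ++ D).
  by rewrite size_cat.
have -> : P = ((pack n ++ append ++ transfer) ++ D) ++ (output ++ [:: IHalt]) ++ [::].
  by rewrite cats0 /P -!catA.
exact: code_at_mid.
Qed.

Lemma ram_run_halt P k s o m : steps P k s (o, m) -> code_at P o [:: IHalt] ->
  forall f, k <= f -> ram_run P f s = Some m.
Proof.
move=> st h f le; rewrite -(subnKC le) st.
by have := h 0 isT; rewrite addn0 /=; case: (f - k) => [|l] /= ->.
Qed.

Theorem theorem4p32 (n : nat) (e : rel 'I_n)
    (e_sym : symmetric e) (e_irr : irreflexive e) (xs : seq 'I_n) :
  exists (P : program) (C : nat),
    forall u v : seq (letter n),
      exists m : nat -> nat,
        ram_run P (C * (size u + size v + 1)) (ram_input u v) = Some m /\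
        (m 0 != 0 <-> twisted_conj e xs u v).
Proof.
have [K0 [K1 H]] := decide_exec e_irr e_sym xs.
have [] := @program_code n (comp 32 (decide_cmd e xs)).
set D := comp 32 _; set P := pack n ++ _ => P_pack P_append P_transfer P_D [P_out P_halt].
(* For [N] letters, reading takes at most [7 * N + 27] steps, the decision [K0 + K1 * (N + 7)], and
   the output 2. *)
exists P, (K0 + 8 * K1 + 40) => u v.
have [m [k [T [st1 [mX mU mT] [l1 l2 l3]]]]] := steps_read u v P_pack P_append P_transfer.
have [s' [k' [ex res lk]]] := H u v T (fun r => m (adr r)) l1 mX mU mT.
have [//|m' st2 ms'] := comp_correct ex P_D (_ : represents m _).
have st3 := steps_straight m' (isT : all straight output) P_out.
exists (effects m' output); split; last by rewrite /effects /= /upd eqxx /= addn0 ms'.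
apply: (ram_run_halt (k := k + (k' + 2)) _ P_halt).
  by apply: steps_trans st1 _; apply: steps_trans st2 st3.
have : K1 * T <= K1 * (size u + size v + 7) by rewrite leq_mul2l l2 orbT.
by nia.
Qed.
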